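(* Let $(A_S,S)$ be an Artin–Tits system of spherical type and let $X\subset S$. Let $\epsilon\in\{1,2\}$ be minimal such that $\Delta_X^{\epsilon}$ is central in $A_X$. Then $$Z_{A_S}(\Delta_X^{\epsilon}) = Com_{A_S}(A_X) = N_{A_S}(A_X) = A_X\cdot QZ_{A_S}(A_X).$$
   Context: Let $S$ be a finite set and $M=(m_{s,t})_{s,t\in S}$ a symmetric matrix with $m_{s,s}=1$ and $m_{s,t}\in\{2,3,\dots\}\cup\{\infty\}$ for $s\neq t$. The associated Artin–Tits system is $(A_S,S)$, where $A_S$ is the group with generators $S$ and relations $\underbrace{sts\cdots}_{m_{s,t}}=\underbrace{tst\cdots}_{m_{s,t}}$ for all $s\ne t$ in $S$ with $m_{s,t}\neq\infty$. The associated Coxeter group $W_S$ is obtained by adding the relations $s^2=1$, $s\in S$. One says that $A_S$ (or $S$) is of spherical type if $W_S$ is finite. For $X\subset S$, $A_X$ is the subgroup of $A_S$ generated by $X$; $(A_X,X)$ is canonically isomorphic to the Artin–Tits system associated to $(m_{s,t})_{s,t\in X}$, and $X$ is of spherical type if $S$ is. $A_X^+$ is the submonoid of $A_S$ generated by $X$. For $X$ of spherical type, $\Delta_X$ denotes the least common multiple of $X$ in the monoid $A_X^+$ (it is the lcm both for left and for right divisibility); its square is central in $A_X$, so $\epsilon$ exists. Notation: $Z_{A_S}(h)=\{g\in A_S\mid gh=hg\}$ for $h \in A_S$; $QZ_{A_S}(A_X)=\{g\in A_S\mid gX=Xg\}$ (equality of sets; the quasi-centralizer); $N_{A_S}(A_X)=\{g\in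 A_S\mid gX\subset A_Xg\}$ (the normalizer); $Com_{A_S}(A_X)=\{g\in A_S\mid gA_Xg^{-1}\cap A_X \text{ has finite index in both } A_X \text{ and } gA_Xg^{-1}\}$ (the commensurator). *)

(* Defs.v *)
From HB Require Import structures.
From mathcomp Require Import all_boot generic_quotient.
From mathcomp Require Import boolp classical_sets functions cardinality.

Set Implicit Arguments.
Unset Strict Implicit.
Unset Printing Implicit Defensive.

Local Open Scope quotient_scope.
Local Open Scope classical_set_scope.
Local Open Scope group_scope.

(* Words in the letters [s] and [s^-1] of an alphabet [S]: the letter [(s, b)]
   stands for [s] if [b = false] and for [s^-1] if [b = true]. *)
Definition word (S : Type) := seq (S * bool).

Definition posw (S : Type) (u : seq S) : word S := [seq (s, false) | s <- u].

Definition invw (S : Type) (u : word S) : word S :=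
  rev [seq (l.1, ~~ l.2) | l <- u].

Section PresentedGroup.
Variables (S : choiceType) (R : word S -> word S -> Prop).

(* The congruence on words generated by free reduction and the relations R. *)
Inductive pres_eq : word S -> word S -> Prop :=
| PresCancel u v s b : pres_eq (u ++ [:: (s, b); (s, ~~ b)] ++ v) (u ++ v)
| PresRel u v r1 r2 : R r1 r2 -> pres_eq (u ++ r1 ++ v) (u ++ r2 ++ v)
| PresRefl u : pres_eq u u
| PresSym u v : pres_eq u v -> pres_eq v u
| PresTrans u v w : pres_eq u v -> pres_eq v w -> pres_eq u w.

Lemma pres_eq_ctx u v p q : pres_eq u v -> pres_eq (p ++ u ++ q) (p ++ v ++ q).
Proof.
elim=> {u v} [u v s b|u v r1 r2 r12|u|u v _ IH|u v w _ IH1 _ IH2].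
- by have := PresCancel (p ++ u) (v ++ q) s b; rewrite -!catA.
- by have := PresRel (p ++ u) (v ++ q) r12; rewrite -!catA.
- exact: PresRefl.
- exact: PresSym.
- exact: PresTrans IH1 IH2.
Qed.

Lemma pres_eq_cat u u' v v' :
  pres_eq u u' -> pres_eq v v' -> pres_eq (u ++ v) (u' ++ v').
Proof.
move=> uu' vv'; apply: (@PresTrans _ (u' ++ v)).
  exact: (pres_eq_ctx [::] v uu').
by have := pres_eq_ctx u' [::] vv'; rewrite !cats0.
Qed.

Lemma invwK : involutive (@invw S).
Proof.
move=> u; rewrite /invw map_rev revK -map_comp -[RHS]map_id.
by apply: eq_map => -[s b] /=; rewrite negbK.
Qed.

Lemma pres_eq_mulwV u : pres_eq (u ++ invw u) [::].
Proof.
elim: u => [|[s b] u IH]; first exact: PresRefl.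
rewrite /invw map_cons rev_cons -cats1 /=.
apply: (@PresTrans _ ([:: (s, b)] ++ [::] ++ [:: (s, ~~ b)])).
  have := pres_eq_ctx [:: (s, b)] [:: (s, ~~ b)] IH.
  by rewrite -!catA.
by have := PresCancel [::] [::] s b.
Qed.

Lemma pres_eq_mulVw u : pres_eq (invw u ++ u) [::].
Proof. by have := pres_eq_mulwV (invw u); rewrite invwK. Qed.

Lemma pres_eq_inv u v : pres_eq u v -> pres_eq (invw u) (invw v).
Proof.
move=> uv; apply: (@PresTrans _ (invw u ++ v ++ invw v)).
  apply: PresSym; rewrite -[X in pres_eq _ X]cats0.
  exact: pres_eq_cat (PresRefl _) (pres_eq_mulwV v).
rewrite catA -[X in pres_eq _ X]cat0s; apply: pres_eq_cat (PresRefl _).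
apply: PresTrans (pres_eq_mulVw u).
exact: pres_eq_cat (PresRefl _) (PresSym uv).
Qed.

Definition pres_eqb (u v : word S) : bool := `[< pres_eq u v >].

Lemma pres_eqb_refl : reflexive pres_eqb.
Proof. by move=> u; apply/asboolP; apply: PresRefl. Qed.

Lemma pres_eqb_sym : symmetric pres_eqb.
Proof. by move=> u v; apply/asboolP/asboolP; apply: PresSym. Qed.

Lemma pres_eqb_trans : transitive pres_eqb.
Proof. by move=> v u w /asboolP uv /asboolP /(PresTrans uv) /asboolP. Qed.

Canonical pres_equiv := EquivRel pres_eqb pres_eqb_refl pres_eqb_sym pres_eqb_trans.

(* The group with generators S and relations r1 = r2 whenever R r1 r2. *)
Definition presented := {eq_quot pres_equiv}.
HB.instance Definition _ := Choice.on presented.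

Definition pres_class (u : word S) : presented := \pi u.

Lemma pres_classP u v : reflect (pres_eq u v) (pres_class u == pres_class v).
Proof. by rewrite eqmodE; apply: asboolP. Qed.

Lemma pres_class_repr (x : presented) : pres_class (repr x) = x.
Proof. exact: reprK. Qed.

Lemma pres_eq_repr u : pres_eq (repr (pres_class u)) u.
Proof. by apply/pres_classP; rewrite pres_class_repr. Qed.

Definition pres_one : presented := pres_class [::].
Definition pres_mul (x y : presented) : presented :=
  pres_class (repr x ++ repr y).
Definition pres_inv (x : presented) : presented := pres_class (invw (repr x)).

Lemma pres_mulE u v :
  pres_mul (pres_class u) (pres_class v) = pres_class (u ++ v).
Proof.
by apply/eqP/pres_classP/pres_eq_cat; apply: pres_eq_repr.
Qed.

Lemma pres_invE u : pres_inv (pres_class u) = pres_class (invw u).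
Proof. by apply/eqP/pres_classP/pres_eq_inv/pres_eq_repr. Qed.

Lemma pres_mulA : associative pres_mul.
Proof.
move=> x y z; rewrite -[x]pres_class_repr -[y]pres_class_repr.
by rewrite -[z]pres_class_repr !pres_mulE catA.
Qed.

Lemma pres_mul1 : left_id pres_one pres_mul.
Proof. by move=> x; rewrite -[x]pres_class_repr pres_mulE. Qed.

Lemma pres_mulg1 : right_id pres_one pres_mul.
Proof. by move=> x; rewrite -[x]pres_class_repr pres_mulE cats0. Qed.

Lemma pres_mulV : left_inverse pres_one pres_inv pres_mul.
Proof.
move=> x; rewrite -[x]pres_class_repr pres_invE pres_mulE.
exact/eqP/pres_classP/pres_eq_mulVw.
Qed.

Lemma pres_mulgV : right_inverse pres_one pres_inv pres_mul.
Proof.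
move=> x; rewrite -[x]pres_class_repr pres_invE pres_mulE.
exact/eqP/pres_classP/pres_eq_mulwV.
Qed.

HB.instance Definition _ := isGroup.Build presented
  pres_mulA pres_mul1 pres_mulg1 pres_mulV pres_mulgV.

Definition pres_gen (s : S) : presented := pres_class [:: (s, false)].

End PresentedGroup.

Section ArtinTits.
Variable S : finType.
Implicit Types m : S -> S -> option nat.

(* [m s t = None] encodes m_{s,t} = infinity. *)
Definition coxeter_matrix m : Prop :=
  [/\ forall s, m s s = Some 1%N,
      forall s t, m s t = m t s
    & forall s t k, s != t -> m s t = Some k -> (2 <= k)%N].

Definition alternating k (s t : S) : word S :=
  posw (mkseq (fun i => if odd i then t else s) k).

Definition braid_rel m (u v : word S) : Prop :=
  exists s t k, [/\ s != t, m s t = Some k,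
    u = alternating k s t & v = alternating k t s].

Definition coxeter_rel m (u v : word S) : Prop :=
  braid_rel m u v \/ exists s, u = posw [:: s; s] /\ v = [::].

Definition artin_group m : groupType := presented (braid_rel m).
Definition coxeter_group m : groupType := presented (coxeter_rel m).

Definition spherical_type m : Prop := finite_set [set: coxeter_group m].

Definition artin_gens m (X : {set S}) : set (artin_group m) :=
  [set pres_gen (braid_rel m) s | s in [set` X]].

End ArtinTits.

Arguments artin_gens {S} m X.

Section Groups.
Variable G : groupType.
Implicit Types (g h d : G) (H K P Y : set G).

Definition gen_subgroup Y : set G :=
  smallest (fun H => group_closed (mem H)) Y.

Definition gen_submonoid Y : set G :=
  smallest (fun P => monoid_closed (mem P)) Y.

Definition ldivides P a b : Prop := exists2 c, P c & b = a * c :> G.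
Definition rdivides P a b : Prop := exists2 c, P c & b = c * a :> G.

Definition is_lcm P (div : G -> G -> Prop) Y d : Prop :=
  [/\ P d, forall y, Y y -> div y d
    & forall d', P d' -> (forall y, Y y -> div y d') -> div d d'].

(* d is the least common multiple of Y in the submonoid generated by Y, for
   both left and right divisibility. *)
Definition is_Delta Y d : Prop :=
  let P := gen_submonoid Y in
  is_lcm P (ldivides P) Y d /\ is_lcm P (rdivides P) Y d.

Definition central_in H h : Prop := forall a, H a -> commute h a.

Definition is_epsilon H d (e : nat) : Prop :=
  [/\ e \in [:: 1; 2]%N, central_in H (d ^+ e)
    & forall e', e' \in [:: 1; 2]%N -> central_in H (d ^+ e') -> (e <= e')%N].

Definition set_mul H K : set G := [set h * k | h in H & k in K].

Definition centralizer h : set G := [set g | g * h = h * g].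

(* The quasi-centralizer and the normalizer of the subgroup generated by Y;
   the former depends on the generating set Y. *)
Definition quasi_centralizer Y : set G :=
  [set g | [set g * y | y in Y] = [set y * g | y in Y]].

Definition normalizer Y : set G :=
  [set g | [set g * y | y in Y] `<=` [set a * g | a in gen_subgroup Y]].

(* K has finitely many left cosets hK, h in H. *)
Definition finite_index K H : Prop :=
  finite_set [set [set h * k | k in K] | h in H].

Definition commensurator H : set G :=
  [set g | let Hg := [set g * a * g^-1 | a in H] in
           finite_index (Hg `&` H) H /\ finite_index (Hg `&` H) Hg].

End Groups.

(* Main.v *)
Require Import Defs.
From mathcomp Require Import all_boot.
From mathcomp Require Import ssralg poly algC cyclotomic.
From mathcomp Require Import zify ring.
From mathcomp Require Import boolp classical_sets functions cardinality.

(* A positive word g with g Delta_X^n = a g, a in A_X, n > 0, is the product of an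
   element of A_X, of a word h without right divisor in X, and of an element of A_X.
   If h ends with a letter t, then h Delta_X^n is right divisible by X and t, hence
   by Delta_{X + t} = v Delta_X, and v turns out to divide h on the right; as v
   conjugates X to a set of letters, an induction on h shows that h X h^-1 consists
   of letters, which must lie in X. So g Delta_X^n g^-1 in A_X with n > 0 forces
   g in A_X QZ(A_X), and this hypothesis holds for g in the centralizer, in the
   normalizer, and (by the pigeonhole principle) in the commensurator.

   The divisibility theory of the positive monoid rests on the Coxeter group:
   Matsumoto's theorem identifies its elements with the simple elements, the monoid
   is shown to be cancellative with lcms by induction on the length, and a reduced
   word of maximal length provides Delta. *)

Set Implicit Arguments.
Unset Strict Implicit.
Unset Printing Implicit Defensive.

Local Open Scope group_scope.

(** * Alternating words and presentations *)

(** The difficulty is to pass from divisibility of h Delta_X^n to divisibility of h. Let Y = v X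
    v^-1. Then v Delta_X^n = Delta_Y^n v is a common left multiple of v and Delta_X^n, and it is the
    least one: otherwise a letter of Y would divide v on the left, and Delta_{X + t} would have a
    word with a square. Hence v divides h on the right as soon as it divides h Delta_X^n. Arbitrary
    powers are carried along because the commensurator only provides some positive power of Delta_X.
    Raising to the power e makes this power commute with the factor of g to the right of h. Elements
    of A_X are fractions over powers of Delta_X^e, and since h has no left divisor in X these
    denominators cancel, which leaves an equation between positive words. The relations only bound
    the order of st from above; a representation over the algebraic numbers shows that it is exactly
    m_{s,t}. The positive monoid embeds in the group thanks to a central element divisible by every
    letter. *)

Definition alt (T : Type) k (s t : T) : seq T :=
  mkseq (fun i => if odd i then t else s) k.
Arguments alt : simpl never.

Lemma size_alt (T : Type) k (s t : T) : size (alt k s t) = k.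
Proof. exact: size_mkseq. Qed.

Lemma altS (T : Type) k (s t : T) : alt k.+1 s t = s :: alt k t s.
Proof.
rewrite /alt /mkseq /= -[1%N]addn0 iotaDl -map_comp; congr cons.
by apply: eq_map => i /=; case: odd.
Qed.

Lemma alt_rcons (T : Type) k (s t : T) :
  alt k.+1 s t = rcons (alt k s t) (if odd k then t else s).
Proof. exact: mkseqS. Qed.

Lemma rev_alt (T : Type) k (s t : T) :
  rev (alt k s t) = if odd k then alt k s t else alt k t s.
Proof.
elim: k s t => [|k IH] s t //.
rewrite {1}altS rev_cons IH /=.
by case ok: (odd k); rewrite /= alt_rcons ok.
Qed.

Lemma alt_cat (T : Type) k l (s t : T) :
  alt (k + l) s t = alt k s t ++ (if odd k then alt l t s else alt l s t).
Proof.
elim: k s t => [|k IH] s t //.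
by rewrite addSn !altS IH /=; case: odd.
Qed.

Lemma all_alt (T : Type) (a : pred T) k (s t : T) :
  a s -> a t -> all a (alt k s t).
Proof.
move=> as_ at_; elim: k s t as_ at_ => [|k IH] s t as_ at_ //.
by rewrite altS /= as_ IH.
Qed.

Definition negl (S : Type) (u : word S) : nat := count snd u.

Lemma posw_cat (S : Type) (u v : seq S) : posw (u ++ v) = posw u ++ posw v.
Proof. exact: map_cat. Qed.

Lemma map_fst_posw (S : Type) (u : seq S) : [seq l.1 | l <- posw u] = u.
Proof. by rewrite -map_comp map_id. Qed.

Definition act (S A : Type) (f : S -> A -> A) (u : seq S) (x : A) : A :=
  foldr f x u.

Lemma act_cat (S A : Type) (f : S -> A -> A) u v x :
  act f (u ++ v) x = act f u (act f v x).
Proof. exact: foldr_cat. Qed.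

Section PresWord.
Variables (S : choiceType) (R : word S -> word S -> Prop).

Definition cls (u : seq S) : presented R := pres_class R (posw u).

Lemma cls_cat u v : cls (u ++ v) = cls u * cls v.
Proof. by rewrite /cls posw_cat; symmetry; apply: pres_mulE. Qed.

Lemma cls_cons s u : cls (s :: u) = pres_gen R s * cls u.
Proof. by rewrite -cat1s cls_cat. Qed.

Lemma cls_rcons u s : cls (rcons u s) = cls u * pres_gen R s.
Proof. by rewrite -cats1 cls_cat. Qed.

Lemma pres_class_letter s b :
  pres_class R [:: (s, b)] = if b then (pres_gen R s)^-1 else pres_gen R s.
Proof.
by case: b => //; rewrite /pres_gen /cls; symmetry; apply: pres_invE.
Qed.

Lemma pres_class_cat u v :
  pres_class R (u ++ v) = pres_class R u * pres_class R v.
Proof. by symmetry; apply: pres_mulE. Qed.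

Lemma pres_classE u v : pres_eq R u v <-> pres_class R u = pres_class R v.
Proof. by split=> [?|/eqP/pres_classP//]; apply/eqP/pres_classP. Qed.

(** Each [f s] being an involution, a letter and its inverse act alike, so the sign may be
    forgotten. Parity, reflections and the geometric representation below are all instances of such
    actions. *)
Lemma pres_eq_act (A : Type) (f : S -> A -> A) :
  (forall s, involutive (f s)) ->
  (forall r1 r2, R r1 r2 ->
     act f [seq l.1 | l <- r1] =1 act f [seq l.1 | l <- r2]) ->
  forall u v, pres_eq R u v ->
     act f [seq l.1 | l <- u] =1 act f [seq l.1 | l <- v].
Proof.
move=> fK fR u v; elim=> {u v} [u v s b|u v r1 r2 /fR r12|u|u v _ IH|u v w _ IH1 _ IH2] x //.
- by rewrite !map_cat !act_cat /= fK.
- by rewrite !map_cat !act_cat r12.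
- by rewrite IH1 IH2.
Qed.

Lemma cls_act (A : Type) (f : S -> A -> A) :
  (forall s, involutive (f s)) ->
  (forall r1 r2, R r1 r2 ->
     act f [seq l.1 | l <- r1] =1 act f [seq l.1 | l <- r2]) ->
  forall u v, cls u = cls v -> act f u =1 act f v.
Proof.
move=> fK fR u v /pres_classE uv x.
by have := pres_eq_act fK fR uv x; rewrite !map_fst_posw.
Qed.

End PresWord.

(** * Coxeter groups *)

Section Coxeter.
Variables (S : finType) (m : S -> S -> option nat).
Hypothesis hm : coxeter_matrix m.

Lemma cox_diag s : m s s = Some 1%N. Proof. by case: hm. Qed.
Lemma cox_sym s t : m s t = m t s. Proof. by case: hm. Qed.
Lemma cox_ge2 s t k : s != t -> m s t = Some k -> (2 <= k)%N.
Proof. by case: hm => _ _; apply. Qed.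

Local Notation W := (coxeter_group m).
Definition wgen (s : S) : W := pres_gen (coxeter_rel m) s.
Definition wd (u : seq S) : W := cls (coxeter_rel m) u.

Lemma wd_cat u v : wd (u ++ v) = wd u * wd v. Proof. exact: cls_cat. Qed.
Lemma wd_nil : wd [::] = 1. Proof. by []. Qed.
Lemma wd_cons s u : wd (s :: u) = wgen s * wd u. Proof. exact: cls_cons. Qed.
Lemma wd1 s : wd [:: s] = wgen s. Proof. by []. Qed.
Lemma wd_rcons u s : wd (rcons u s) = wd u * wgen s.
Proof. exact: cls_rcons. Qed.

Lemma wgen2 s : wgen s * wgen s = 1.
Proof.
rewrite -wd1 -wd_cat; apply/pres_classE.
have := @PresRel _ (coxeter_rel m) [::] [::] (posw [:: s; s]) [::].
by rewrite /= ; apply; right; exists s.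
Qed.

Lemma wgenV s : (wgen s)^-1 = wgen s.
Proof. by apply: mulg1_eq; rewrite wgen2. Qed.

Lemma wgenK s : involutive (fun g : W => wgen s * g).
Proof. by move=> g; rewrite mulgA wgen2 mul1g. Qed.

Lemma wgenKr s : involutive (fun g : W => g * wgen s).
Proof. by move=> g; rewrite -mulgA wgen2 mulg1. Qed.

Lemma wd_rev u : wd (rev u) = (wd u)^-1.
Proof.
elim: u => [|s u IH]; first by rewrite wd_nil invg1.
by rewrite rev_cons wd_rcons wd_cons invgM wgenV IH.
Qed.

Lemma wd_alt s t k : m s t = Some k -> wd (alt k s t) = wd (alt k t s).
Proof.
have [->|st mst] := eqVneq s t; first by [].
apply/pres_classE; have := @PresRel _ (coxeter_rel m) [::] [::]
  (alternating k s t) (alternating k t s).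
by rewrite /= !cats0; apply; left; exists s, t, k.
Qed.

Lemma wd_surj (g : W) : exists u, wd u = g.
Proof.
rewrite -[g]pres_class_repr; elim: (repr g) => [|[s b] w [u uw]].
  by exists [::].
exists (s :: u); rewrite wd_cons uw -[(s, b) :: w]cat1s pres_class_cat.
by rewrite pres_class_letter; case: b => //=; rewrite -/(wgen s) wgenV.
Qed.

Lemma wd_act (A : Type) (f : S -> A -> A) :
  (forall s, involutive (f s)) ->
  (forall s t k, s != t -> m s t = Some k ->
     act f (alt k s t) =1 act f (alt k t s)) ->
  forall u v, wd u = wd v -> act f u =1 act f v.
Proof.
move=> fK fR; apply: cls_act => // r1 r2 [|[s [-> ->]]] /=.
  by move=> [s [t [k [st mst -> ->]]]]; rewrite !map_fst_posw; apply: fR.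
by move=> x; rewrite /= fK.
Qed.

Definition wlen (g : W) : nat :=
  ex_minn (P := fun n => `[< exists u, size u = n /\ wd u = g >])
    (let: ex_intro u e := wd_surj g in
     ex_intro _ (size u) (introT (asboolP _) (ex_intro _ u (conj erefl e)))).

Lemma wlenP g : exists2 u, size u = wlen g & wd u = g.
Proof. by rewrite /wlen; case: ex_minnP => n /asboolP[u [? ?]] _; exists u. Qed.

Lemma wlen_le u : (wlen (wd u) <= size u)%N.
Proof.
rewrite /wlen; case: ex_minnP => n _; apply; apply/asboolP.
by exists u.
Qed.

Definition reduced u := wlen (wd u) == size u.

Lemma reducedE u : reduced u = (size u <= wlen (wd u))%N.
Proof. by rewrite /reduced eqn_leq wlen_le. Qed.

Lemma reduced_ex g : exists2 u, reduced u & wd u = g.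
Proof. by have [u su ug] := wlenP g; exists u => //; rewrite /reduced ug su. Qed.

Lemma wlenV g : wlen g^-1 = wlen g.
Proof.
suff le h : (wlen h^-1 <= wlen h)%N by apply/eqP; rewrite eqn_leq le -{1}[g]invgK le.
by have [u <- <-] := wlenP h; rewrite -wd_rev -(size_rev u) wlen_le.
Qed.

Lemma wlenM g h : (wlen (g * h) <= wlen g + wlen h)%N.
Proof.
have [u su ug] := wlenP g; have [v sv vh] := wlenP h.
by rewrite -su -sv -ug -vh -wd_cat -size_cat wlen_le.
Qed.

Lemma reduced_rev u : reduced (rev u) = reduced u.
Proof. by rewrite /reduced wd_rev wlenV size_rev. Qed.

Lemma reduced_catl u v : reduced (u ++ v) -> reduced u.
Proof.
rewrite !reducedE wd_cat size_cat => h.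
have := leq_trans h (wlenM _ _); have := wlen_le v; lia.
Qed.

Lemma reduced_catr u v : reduced (u ++ v) -> reduced v.
Proof.
rewrite !reducedE wd_cat size_cat => h.
have := leq_trans h (wlenM _ _); have := wlen_le u; lia.
Qed.

Lemma reduced_wd u v : wd u = wd v -> size u = size v -> reduced u = reduced v.
Proof. by rewrite /reduced => -> ->. Qed.

Lemma wd_odd u v : wd u = wd v -> odd (size u) = odd (size v).
Proof.
have actE w : act (fun=> negb) w false = odd (size w) :> bool.
  by elim: w => //= s w ->.
rewrite -!actE => uv; apply: (wd_act (f := fun _ : S => negb) _ _ uv).
  by move=> _ b; rewrite negbK.
move=> s t k _ _ b; have sE w : act (fun _ : S => negb) w b = b (+) odd (size w).
  by elim: w => [|? w /= ->]; rewrite ?addbF ?addbN.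
by rewrite !sE !size_alt.
Qed.

Lemma wlen_odd u : odd (wlen (wd u)) = odd (size u).
Proof. by have [v <- /wd_odd] := wlenP (wd u). Qed.

(** Equality is excluded because the parity of the length is an invariant of the element. *)
Lemma wlen_gen_lt s g : (wlen (wgen s * g) < wlen g)%N = ~~ (wlen g < wlen (wgen s * g))%N.
Proof.
have [u su <-] := wlenP g; have := wlen_odd (s :: u); rewrite wd_cons /= -wlen_odd.
by case: ltngtP => // ->; case: odd.
Qed.

Lemma wlen1 g : wlen (wgen g) = 1%N.
Proof.
have := wlen_odd [:: g]; have := wlen_le [:: g]; rewrite wd1 /=.
by case: wlen => [|[]].
Qed.

Lemma wlen_desc s g : (wlen (wgen s * g) < wlen g)%N -> wlen g = (wlen (wgen s * g)).+1.
Proof.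
move=> h; have := wlenM (wgen s) (wgen s * g).
by rewrite wgenK wlen1 => ?; lia.
Qed.

Lemma wlen_asc s g : ~~ (wlen (wgen s * g) < wlen g)%N -> wlen (wgen s * g) = (wlen g).+1.
Proof.
rewrite wlen_gen_lt negbK => h; have := wlenM (wgen s) g.
by rewrite wlen1; lia.
Qed.

Definition desc s (g : W) := (wlen (wgen s * g) < wlen g)%N.

Lemma desc_word s g : desc s g ->
  exists2 u, reduced (s :: u) & wd (s :: u) = g.
Proof.
move=> /wlen_desc h; have [u ru ug] := reduced_ex (wgen s * g).
have sug : wd (s :: u) = g by rewrite wd_cons ug wgenK.
exists u => //; rewrite /reduced sug h -ug /=.
by rewrite (eqP ru).
Qed.

Lemma desc_cons s u : reduced (s :: u) -> desc s (wd (s :: u)).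
Proof.
move=> h; rewrite /desc wd_cons wgenK -wd_cons (eqP h) /=.
by rewrite ltnS wlen_le.
Qed.

Lemma reduced_cons s u : reduced u -> reduced (s :: u) = ~~ desc s (wd u).
Proof.
move=> ru; apply/idP/idP => [rsu|].
  by rewrite /desc -wd_cons (eqP rsu) (eqP ru) /= -leqNgt.
by move=> /wlen_asc h; rewrite /reduced wd_cons h (eqP ru).
Qed.

End Coxeter.

(** * The deletion condition *)

Section Deletion.
Variables (S : finType) (m : S -> S -> option nat).
Hypothesis hm : coxeter_matrix m.
Local Notation W := (coxeter_group m).
Local Notation wd := (@wd S m).
Local Notation wgen := (@wgen S m).

(* The reflections r = (wd v)^-1 s (wd v), one for each suffix s :: v of u; the
   parity of the multiplicity of r only depends on the element wd u. *)
Fixpoint refl (u : seq S) : seq W :=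
  if u is s :: v then (wd v)^-1 * wgen s * wd v :: refl v else [::].

Lemma size_refl u : size (refl u) = size u.
Proof. by elim: u => //= s u ->. Qed.

(** The classical action on signed reflections, extended to all of W in the first coordinate so that
    reflections need not be singled out. *)
Definition reflact (s : S) (p : W * bool) : W * bool :=
  (wgen s * p.1 * wgen s, p.2 (+) (p.1 == wgen s)).

Lemma reflactK s : involutive (reflact s).
Proof.
move=> [x b]; rewrite /reflact /= !mulgA wgen2 mul1g -mulgA wgen2 mulg1.
congr pair; rewrite -addbA.
have -> : (wgen s * x * wgen s == wgen s) = (x == wgen s).
  rewrite -{3}[wgen s]mul1g (inj_eq (mulIg _)) -(wgen2 m s) (inj_eq (mulgI _)).
  by [].
by rewrite addbb addbF.
Qed.

Lemma act_reflact u x b :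
  act reflact u (x, b) =
  (wd u * x * (wd u)^-1, b (+) odd (count_mem x (refl u))).
Proof.
elim: u => [|s u IH] /=; first by rewrite wd_nil mul1g invg1 mulg1 addbF.
rewrite -/(act reflact u (x, b)) IH /reflact /=; congr pair.
  by rewrite wd_cons invgM wgenV !mulgA.
have -> : (wd u * x * (wd u)^-1 == wgen s) = ((wd u)^-1 * wgen s * wd u == x).
  rewrite -(inj_eq (mulgI (wd u)^-1)) -(inj_eq (mulIg (wd u))) !mulgA mulVg.
  by rewrite mul1g mulgVK eq_sym.
by rewrite oddD oddb -addbA [odd _ (+) _]addbC.
Qed.

Lemma refl_rev_alt k a b :
  refl (rev (alt k a b)) = rev [seq wd (alt j.*2.+1 a b) | j <- iota 0 k].
Proof.
elim: k => [|k IH] //.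
have -> : iota 0 k.+1 = rcons (iota 0 k) k by rewrite -addn1 iotaD cats1.
rewrite alt_rcons rev_rcons [LHS]/= IH map_rcons rev_rcons.
congr cons; rewrite wd_rev invgK.
rewrite -addnn -addnS alt_cat wd_cat -mulgA; congr (_ * _).
rewrite -wd_rev rev_alt !altS.
by case ok: (odd k) => /=; rewrite ?wd_cons //.
Qed.

Lemma wd_alt_double k a b : m a b = Some k -> wd (alt k.*2 a b) = 1.
Proof.
move=> /wd_alt mab; rewrite -addnn alt_cat wd_cat mab.
have -> : (if odd k then alt k b a else alt k a b) = rev (alt k b a).
  by rewrite rev_alt.
by rewrite wd_rev mulgV.
Qed.

(** Cut the trivial alternating word of length 2k after 2j+1 letters: the two pieces are inverse to
    each other, and an alternating word of odd length is a palindrome, hence its own inverse. *)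
Lemma wd_alt_palindrome k j a b : m a b = Some k -> (j < k)%N ->
  wd (alt j.*2.+1 a b) = wd (alt (k - j.+1).*2.+1 b a).
Proof.
move=> mab jk; have := wd_alt_double mab.
have -> : k.*2 = (j.*2.+1 + (k - j.+1).*2.+1)%N by lia.
rewrite alt_cat [odd _]/= odd_double wd_cat => /(congr1 (fun g => (wd (alt j.*2.+1 a b))^-1 * g)).
rewrite mulKg mulg1 => ->.
by rewrite -wd_rev rev_alt /= odd_double.
Qed.

Lemma refl_alt_perm k a b : m a b = Some k ->
  perm_eq (refl (rev (alt k a b))) (refl (rev (alt k b a))).
Proof.
move=> mab; rewrite !refl_rev_alt perm_rev.
have -> : [seq wd (alt j.*2.+1 a b) | j <- iota 0 k] =
          rev [seq wd (alt j.*2.+1 b a) | j <- iota 0 k]; last by [].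
apply: (@eq_from_nth _ 1) => [|j]; first by rewrite size_rev !size_map.
rewrite size_map size_iota => jk.
rewrite nth_rev size_map size_iota // !(nth_map 0%N) ?size_iota ?ltn_subrL //; try lia.
rewrite !nth_iota //; try lia.
by rewrite !add0n (wd_alt_palindrome mab jk).
Qed.

Lemma wd_refl_odd u v x : wd u = wd v ->
  odd (count_mem x (refl u)) = odd (count_mem x (refl v)).
Proof.
move=> uv; have := @wd_act S m (W * bool)%type reflact reflactK _ u v uv (x, false).
rewrite !act_reflact => h; suff/h[_ ->] : forall s t k, s != t -> m s t = Some k ->
  act reflact (alt k s t) =1 act reflact (alt k t s) by [].
move=> s t k _ mst [y b]; rewrite !act_reflact (wd_alt mst); congr (_, _ (+) odd _).
apply/permP; have mts : m t s = Some k by rewrite (cox_sym hm).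
have := refl_alt_perm mst; rewrite !rev_alt.
by case: odd => //; rewrite perm_sym.
Qed.

(** A reflection occurring once in [refl u] has odd multiplicity, so it occurs for every word of the
    same element, in particular for a shortest one. *)
Lemma uniq_refl_reduced u : uniq (refl u) -> reduced m u.
Proof.
move=> uu; rewrite reducedE; have [v <- vu] := wlenP (wd u).
rewrite -!size_refl; apply: uniq_leq_size => // x xu.
rewrite -has_pred1 has_count lt0n.
have := wd_refl_odd x vu; rewrite (count_uniq_mem x uu) xu /=.
by apply: contraTneq => ->.
Qed.

Lemma mem_refl x u : x \in refl u ->
  exists q t r, u = q ++ t :: r /\ x = (wd r)^-1 * wgen t * wd r.
Proof.
elim: u => //= s u IH; rewrite inE => /orP[/eqP->|/IH[q [t [r [-> ->]]]]].
  by exists [::], s, u.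
by exists (s :: q), t, r.
Qed.

(** If s and t produce the same reflection x, then s q t r = q t r x = q t t r = q r. *)
Lemma deletion u : ~~ reduced m u -> exists p s q t r,
  u = p ++ s :: q ++ t :: r /\ wd u = wd (p ++ q ++ r).
Proof.
move/(contra (@uniq_refl_reduced u)).
elim: u => //= s u IH; rewrite negb_and negbK => /orP[].
  move=> /mem_refl[q [t [r [-> e]]]]; exists [::], s, q, t, r; split=> //.
  move: e => /(congr1 (fun g => wd (q ++ t :: r) * g)).
  rewrite !mulgA mulgV mul1g wd_cons => ->.
  by rewrite wd_cat wd_cons -!mulgA mulVKg (wgenK t (wd r)) cat0s wd_cat.
move=> /IH[p [s' [q [t [r [-> e]]]]]]; exists (s :: p), s', q, t, r; split=> //=.
by rewrite wd_cons e wd_cons.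
Qed.

(** Deletion only erases letters, so it stays inside X. *)
Lemma parabolic_reduced (X : pred S) (u : seq S) : all X u ->
  exists v, [/\ all X v, reduced m v, wd v = wd u & (size v <= size u)%N].
Proof.
have [n] := ubnP (size u); elim: n u => // n IH u un Xu.
have [ru|/deletion] := boolP (reduced m u); first by exists u.
move=> [p [s [q [t [r [ue ->]]]]]].
have [||v [Xv rv vE vs]] := IH (p ++ q ++ r).
- by move: un; rewrite ue !size_cat /= size_cat /=; lia.
- by move: Xu; rewrite ue !all_cat /= all_cat /= => /and4P[-> _ -> /andP[_ ->]].
exists v; split=> //; apply: leq_trans vs _.
by rewrite ue !size_cat /= size_cat /=; lia.
Qed.

Lemma cat_cons_split (T : Type) (a b p r : seq T) s : a ++ b = p ++ s :: r ->
  (exists a2, a = p ++ s :: a2 /\ r = a2 ++ b) \/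
  (exists p2, p = a ++ p2 /\ b = p2 ++ s :: r).
Proof.
elim: a p => [|x a IH] [|y p] /=.
- by move=> ->; right; exists [::].
- by move=> ->; right; exists (y :: p).
- by move=> [-> <-]; left; exists a.
by move=> [-> /IH[[a2 [-> ->]]|[p2 [-> ->]]]]; [left; exists a2|right; exists p2].
Qed.

(* [d] is the minimal element of the coset of [g] under the subgroup generated by [X]. *)
Lemma coset_decomposition (X : pred S) g : exists u d : seq S,
  [/\ all X u, reduced m u, wd (u ++ d) = g
    & forall w, all X w -> reduced m w -> reduced m (w ++ d)].
Proof.
pose P n := `[< exists u d, [/\ all X u, wd (u ++ d) = g & size d = n] >].
have exP : exists n, P n.
  by have [d dg] := wd_surj g; exists (size d); apply/asboolP; exists [::], d.
have [n /asboolP[u0 [d [Xu0 u0g dn]]] nmin] := ex_minnP exP.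
have [u [Xu ru uu0 _]] := parabolic_reduced Xu0.
have ug : wd (u ++ d) = g by rewrite wd_cat uu0 -wd_cat.
exists u, d; split=> // w Xw rw; apply/negPn/negP => /deletion.
have dmin a d' : all X a -> wd (w ++ d) = wd (a ++ d') -> (size d <= size d')%N.
  move=> Xa e; rewrite dn; apply: nmin; apply/asboolP.
  exists (u ++ rev w ++ a), d'; split=> //; first by rewrite !all_cat Xu all_rev Xw.
  move: e; rewrite -!catA !wd_cat wd_rev -ug wd_cat => <-.
  by rewrite mulKg.
move=> [p [s [q [t [r [wdE e]]]]]].
(* The two deleted letters cannot both lie in w, which is reduced; if at least one lies in d, the
   coset has a representative shorter than d. *)
have [[a2 [wE]]|[p2 [pE dE]]] := cat_cons_split wdE; last first.
  have := dmin w (p2 ++ q ++ r) Xw; rewrite e pE -!catA dE => /(_ erefl).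
  by rewrite !size_cat /= size_cat /=; lia.
move=> /esym qE'; have [[b2 [a2E rE]]|[q2 [qE dE]]] := cat_cons_split qE'.
  have := e; rewrite rE !catA wd_cat [in RHS]wd_cat => /mulIg.
  move: rw; rewrite wE a2E reducedE => rw e'.
  have := leq_trans rw (eq_leq (congr1 (@wlen S m) e')).
  have := wlen_le m ((p ++ q) ++ b2); rewrite !size_cat /= size_cat /=; lia.
have Xpa : all X (p ++ a2).
  by move: Xw; rewrite wE !all_cat /= => /and3P[-> _ ->].
have := dmin (p ++ a2) (q2 ++ r) Xpa; rewrite e qE -!catA => /(_ erefl).
by rewrite dE !size_cat /=; lia.
Qed.

End Deletion.

(** * The order of a product of two generators *)

Section Geometric.
Import GRing.Theory.
Local Open Scope ring_scope.
Variables (S : finType) (m : S -> S -> option nat).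
Hypothesis hm : coxeter_matrix m.

(* The generators with m s t = None impose no relation, so their product may be
   given any order 2 <= M. *)
Variable M : nat.
Hypothesis M0 : (1 < M)%N.

Definition ord2 s t : nat := if m s t is Some k then k else M.

Lemma ord2_gt0 s t : (0 < ord2 s t)%N.
Proof.
rewrite /ord2; case mst: (m s t) => [k|]; last exact: ltnW.
have [e|st] := eqVneq s t; last exact: leq_trans (cox_ge2 hm st mst).
by move: mst; rewrite e (cox_diag hm) => -[<-].
Qed.

(** The order is written as a successor to make it positive; it equals [(ord2 s t).*2]. Only the
    order of the root is used, so any primitive root may replace exp(i pi / m). *)
Definition zeta s t : algC :=
  sval (C_prim_root_exists (ltn0Sn (ord2 s t).-1.*2.+1)).

Lemma zeta_prim s t : ((ord2 s t).*2).-primitive_root (zeta s t).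
Proof.
rewrite /zeta; case: C_prim_root_exists => z /=.
by rewrite -doubleS prednK // ord2_gt0.
Qed.

Lemma ord2C s t : ord2 s t = ord2 t s.
Proof. by rewrite /ord2 (cox_sym hm). Qed.

Lemma zetaC s t : zeta s t = zeta t s.
Proof. by rewrite /zeta ord2C. Qed.

Lemma zeta_neq0 s t : zeta s t != 0.
Proof.
apply/eqP => z0; have := prim_expr_order (zeta_prim s t).
rewrite z0 expr0n; have := ord2_gt0 s t.
by case: ord2 => //= n _ /esym /eqP; rewrite oner_eq0.
Qed.

(** Up to the choice of the root, this is -2 cos(pi / m). *)
Definition cartan s t : algC := - (zeta s t + (zeta s t)^-1).

Lemma cartanC s t : cartan s t = cartan t s.
Proof. by rewrite /cartan zetaC. Qed.

Lemma cartan_diag s : cartan s s = 2.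
Proof.
have := zeta_prim s s; rewrite /cartan; move: (zeta s s) => z.
rewrite /ord2 (cox_diag hm) => zP.
have z2 : z ^+ 2 = 1 := prim_expr_order zP.
have /eqP : (z - 1) * (z + 1) = 0 by rewrite -subr_sqr z2 expr1n subrr.
rewrite mulf_eq0 subr_eq0 addr_eq0 => /orP[/eqP z1|/eqP ->].
  by have := prim_order_dvd zP 1; rewrite expr1 z1 eqxx.
by rewrite invrN1 opprD !opprK.
Qed.

(* The contragredient of the geometric representation. *)
Definition geom (s : S) (phi : S -> algC) : S -> algC :=
  fun u => phi u - cartan s u * phi s.

Lemma geomK s : involutive (geom s).
Proof.
move=> phi; apply/funext => u; rewrite /geom cartan_diag.
by ring.
Qed.

Section Pair.
Variables (a b : S) (phi : S -> algC).
Let z := zeta a b.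
Let d := z - z^-1.
Let E n := z ^+ n - z^-1 ^+ n.
Let psi k := act geom (rev (alt k a b)) phi.

(** The coordinate read by the reflection applied at step k, thus the multiple of a Cartan row that
    this step subtracts. *)
Definition geomc k := psi k (if odd k then b else a).
Let y k := psi k (if odd k then a else b).

Let psiS k : psi k.+1 = geom (if odd k then b else a) (psi k).
Proof. by rewrite /psi alt_rcons rev_rcons. Qed.

Let xS k : geomc k.+1 = y k + (z + z^-1) * geomc k.
Proof.
rewrite /geomc /y psiS /geom /=.
by case: odd => /=; rewrite 1?[cartan b a]cartanC /cartan -/z mulNr opprK.
Qed.

Let yS k : y k.+1 = - geomc k.
Proof.
rewrite /geomc /y psiS /geom /=.
by case: odd => /=; rewrite cartan_diag; ring.
Qed.

(** These coordinates satisfy x_{k+2} = (z + z^-1) x_{k+1} - x_k, whose solutions are combinations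
    of the quantum integers (z^n - z^-n) / (z - z^-1). The factor d avoids the division, as d = 0
    when a = b. *)
Lemma geom_coef k : d * geomc k = E k.+1 * phi a + E k * phi b.
Proof.
suff : d * geomc k = E k.+1 * phi a + E k * phi b /\
       d * geomc k.+1 = E k.+2 * phi a + E k.+1 * phi b by case.
elim: k => [|k [IH1 IH2]].
  rewrite xS /E /d /geomc /y /psi /= !exprS expr0.
  by split; field; exact: zeta_neq0.
split=> //; rewrite xS yS mulrDr mulrN IH1 [d * (_ * _)]mulrCA IH2 /E.
rewrite !exprS; set p := z ^+ k; set q := z^-1 ^+ k.
by field; exact: zeta_neq0.
Qed.

Lemma geom_sum k u : psi k u = phi u
  - cartan a u * (\sum_(i < k | ~~ odd i) geomc i)
  - cartan b u * (\sum_(i < k | odd i) geomc i).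
Proof.
elim: k => [|k IH]; first by rewrite !big_ord0 !mulr0 !subr0.
rewrite psiS /geom IH -/(geomc k) !(big_mkcond (fun i : 'I__ => odd _)).
rewrite !(big_mkcond (fun i : 'I__ => ~~ odd _)) !big_ord_recr /=.
by case: (odd k) => /=; rewrite addr0; ring.
Qed.

End Pair.

(** By [geom_sum], a braid relation amounts to the equality of the coefficients of [cartan a] on
    both sides, and of [cartan b]. Their difference after k steps is governed by z^k - z^-k, which
    vanishes for k = m a b. *)
Lemma geom_balance a b phi k :
  let z := zeta a b in
  (z - z^-1) * (\sum_(i < k | ~~ odd i) geomc a b phi i
                - \sum_(i < k | odd i) geomc b a phi i)
  = (z ^+ k - z^-1 ^+ k) * (if odd k then phi a else - phi b).
Proof.
move=> z; elim: k => [|k]; first by rewrite !big_ord0 !expr0 !subrr mulr0 mul0r.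
rewrite !(big_mkcond (fun i : 'I__ => odd _)).
rewrite !(big_mkcond (fun i : 'I__ => ~~ odd _)) !big_ord_recr /= => IH.
have ab := geom_coef a b phi k; have ba := geom_coef b a phi k.
rewrite [zeta b a]zetaC -/z in ab ba.
move: IH; case ok: (odd k) => /= IH; rewrite !addr0.
  by rewrite opprD addrA mulrDr IH mulrN ba; ring.
by rewrite [X in _ * X]addrAC mulrDr IH ab; ring.
Qed.

Lemma zeta_order a b n : zeta a b ^+ n.*2 = 1 -> (ord2 a b %| n)%N.
Proof.
move/eqP; rewrite -(prim_order_dvd (zeta_prim a b)) -!muln2.
by rewrite dvdn_pmul2r.
Qed.

Lemma ord2_gt1 a b : a != b -> (1 < ord2 a b)%N.
Proof.
by rewrite /ord2; case mab: (m a b) => [k|] // ab; exact: (cox_ge2 hm ab mab).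
Qed.

Lemma zeta_sub_neq0 a b : a != b -> zeta a b - (zeta a b)^-1 != 0.
Proof.
move=> ab; rewrite subr_eq0; apply/eqP => zV.
suff /zeta_order : zeta a b ^+ 1.*2 = 1 by rewrite dvdn1 => /eqP h; have := ord2_gt1 ab; rewrite h.
by rewrite expr2 {2}zV mulfV // zeta_neq0.
Qed.

Lemma geom_sum_eq a b phi k : a != b -> m a b = Some k ->
  \sum_(i < k | ~~ odd i) geomc a b phi i = \sum_(i < k | odd i) geomc b a phi i.
Proof.
move=> ab mab; apply/eqP; rewrite -subr_eq0.
have := geom_balance a b phi k; rewrite /=.
have -> : zeta a b ^+ k - (zeta a b)^-1 ^+ k = 0.
  have := prim_expr_order (zeta_prim a b); rewrite /ord2 mab -addnn exprD => zk.
  apply/eqP; rewrite subr_eq0 exprVn -[X in X == _]mulr1 -(mulfV (x := zeta a b ^+ k)).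
    by rewrite mulrA zk mul1r.
  by rewrite expf_neq0 // zeta_neq0.
by rewrite mul0r => /eqP; rewrite mulf_eq0 (negPf (zeta_sub_neq0 ab)).
Qed.

Lemma geom_braid a b k : a != b -> m a b = Some k ->
  act geom (rev (alt k a b)) =1 act geom (rev (alt k b a)).
Proof.
move=> ab mab phi; apply/funext => u; rewrite !geom_sum.
rewrite (geom_sum_eq phi ab mab) -(@geom_sum_eq b a phi k) 1?eq_sym //.
  by ring.
by rewrite (cox_sym hm).
Qed.

Lemma wd_geom u v : wd m u = wd m v -> act geom u =1 act geom v.
Proof.
apply: wd_act; first exact: geomK.
move=> s t k st mst phi.
have mts : m t s = Some k by rewrite (cox_sym hm).
have ts : t != s by rewrite eq_sym.
have := geom_braid st mst phi; have := geom_braid ts mts phi.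
by rewrite !rev_alt; case: odd.
Qed.

Lemma wd_alt_trivial a b i : a != b -> wd m (alt i.*2 a b) = 1%g -> (ord2 a b %| i)%N.
Proof.
move=> ab h.
have geom1 phi : (zeta a b - (zeta a b)^-1) * phi a =
    (zeta a b ^+ i.*2.+1 - (zeta a b)^-1 ^+ i.*2.+1) * phi a +
    (zeta a b ^+ i.*2 - (zeta a b)^-1 ^+ i.*2) * phi b.
  rewrite -geom_coef /geomc odd_double.
  have /wd_geom-> // : wd m (rev (alt i.*2 a b)) = wd m [::].
  by rewrite wd_rev h invg1.
apply: zeta_order; move: (zeta_neq0 a b) (zeta_sub_neq0 ab) geom1.
set z := zeta a b => z0 zd geom1.
(* The indicator of b yields z^(2i) = z^(-2i); the indicator of a then yields z^(2i) = 1. *)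
have := geom1 (fun u => (u == b)%:R).
rewrite eqxx (negPf ab) !mulr0 add0r mulr1 => /esym/eqP; rewrite subr_eq0 => /eqP e0.
have := geom1 (fun u => (u == a)%:R).
rewrite eqxx (eq_sym b) (negPf ab) mulr0 addr0 !mulr1 !exprS -e0 -mulrBl => /eqP.
rewrite eq_sym -[X in _ == X]mulr1 => /eqP; exact: mulfI.
Qed.

End Geometric.

Section Order.
Variables (S : finType) (m : S -> S -> option nat).
Hypothesis hm : coxeter_matrix m.

Lemma wd_alt_order s t i : s != t -> (0 < i)%N -> wd m (alt i.*2 s t) = 1 ->
  exists2 k, m s t = Some k & (k <= i)%N.
Proof.
(* The value M = i + 1 settles the infinite case: i + 1 would divide i > 0. *)
move=> st i0 h; have := @wd_alt_trivial S m hm i.+1 i0 s t i st h.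
rewrite /ord2; case: (m s t) => [k|] /(dvdn_leq i0) ki; first by exists k.
by rewrite ltnn in ki.
Qed.

End Order.

(** * Subgroups generated by two letters *)

Section Dihedral.
Variables (S : finType) (m : S -> S -> option nat).
Hypothesis hm : coxeter_matrix m.
Local Notation W := (coxeter_group m).
Local Notation wd := (@wd S m).
Local Notation wgen := (@wgen S m).
Local Notation reduced := (@reduced S m).
Local Notation desc := (@desc S m).

(** The reverse of one word followed by the other is a trivial alternating word of length k + j,
    which is even by parity. *)
Lemma wd_alt_opposite s t k j : s != t -> (0 < k + j)%N ->
  wd (alt k s t) = wd (alt j t s) ->
  exists2 k0, m s t = Some k0 & (k0.*2 <= k + j)%N.
Proof.
move=> st kj0 e.
have okj : odd k = odd j by have := wd_odd e; rewrite !size_alt.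
have kjE : ((k + j)./2.*2 = j + k)%N.
  by rewrite [RHS]addnC -[RHS]odd_double_half oddD okj addbb.
have kj2 : (0 < (k + j)./2)%N by lia.
have e1 : wd (rev (alt j t s) ++ alt k s t) = 1 by rewrite wd_cat wd_rev e mulVg.
have [ts] : t != s by rewrite eq_sym.
move: e1; rewrite rev_alt; case oj: (odd j) => e1.
  have e2 : wd (alt (k + j)./2.*2 t s) = 1 by rewrite kjE alt_cat oj.
  have [k0 mts k0le] := wd_alt_order hm ts kj2 e2.
  by exists k0; [rewrite (cox_sym hm)|lia].
have e2 : wd (alt (k + j)./2.*2 s t) = 1 by rewrite kjE alt_cat oj.
by have [k0 mst k0le] := wd_alt_order hm st kj2 e2; exists k0 => //; lia.
Qed.

Lemma reduced_pair s t (u : seq S) : all (pred2 s t) u -> reduced u ->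
  u = alt (size u) s t \/ u = alt (size u) t s.
Proof.
elim: u => [|a u IH] /=; first by left.
move=> /andP[ast Xu] ru; have ru' : reduced u by apply: (@reduced_catr _ _ [:: a]).
have {IH} := IH Xu ru'; case: u ru Xu ru' => [|b u] ru Xu ru'.
  by move=> _; case/pred2P: ast => ->; [left|right].
have nab : a != b.
  apply: contraL ru => /eqP ->; rewrite reducedE !wd_cons wgenK -ltnNge.
  by apply: leq_ltn_trans (wlen_le _ _) _; rewrite /= ltnW.
rewrite /= !altS.
move=> [[bE uE]|[bE uE]]; move: ast nab; rewrite bE.
  by move=> /pred2P[]-> ; rewrite ?eqxx // => _; right; rewrite -uE.
by move=> /pred2P[]-> ; rewrite ?eqxx // => _; left; rewrite -uE.
Qed.

Lemma reduced_alt s t k k0 : s != t -> m s t = Some k0 -> (k <= k0)%N ->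
  reduced (alt k s t).
Proof.
move=> st mst kk0; have Xk : all (pred2 s t) (alt k s t).
  by apply: all_alt; rewrite /= eqxx ?orbT.
have [v [Xv rv vE vk]] := parabolic_reduced hm Xk; rewrite size_alt in vk.
apply/eqP; rewrite -vE (eqP rv) size_alt; apply/eqP; rewrite eqn_leq vk leqNgt.
apply/negP => lvk; have k0ge := cox_ge2 hm st mst.
have [ve|ve] := reduced_pair Xv rv; last first.
  have [|k1] := wd_alt_opposite st _ (etrans (esym vE) (congr1 _ ve)); first by lia.
  by rewrite mst => -[<-] ?; lia.
have kj0 : (0 < k - size v + 0)%N by lia.
have := vE; rewrite {1}ve -{1}(subnKC vk) alt_cat wd_cat -[LHS]mulg1 => /mulgI.
have ts : t != s by rewrite eq_sym.
case: odd => /esym.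
  move=> /(@wd_alt_opposite t s _ 0%N ts kj0)[k1]; rewrite (cox_sym hm) mst => -[<-] ?.
  lia.
by move=> /(@wd_alt_opposite s t _ 0%N st kj0)[k1]; rewrite mst => -[<-] ?; lia.
Qed.

Lemma size_reduced_alt s t k k0 : s != t -> m s t = Some k0 ->
  reduced (alt k s t) -> (k <= k0)%N.
Proof.
move=> st mst rk; rewrite leqNgt; apply/negP => k0k.
have := rk; have -> : k = (k0.+1 + (k - k0.+1))%N by rewrite subnKC.
rewrite alt_cat => /reduced_catl; rewrite altS reducedE wd_cons.
rewrite (wd_alt (k := k0)) 1?(cox_sym hm) // => h.
have k0ge := cox_ge2 hm st mst.
move: h; rewrite /= size_alt; case: k0 mst k0k k0ge => // k0 mst k0k k0ge.
by rewrite altS wd_cons wgenK => h; have := leq_trans h (wlen_le _ _); rewrite size_alt; lia.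
Qed.

Lemma desc_cat (X : pred S) s u d : X s -> reduced u ->
  (forall w, all X w -> reduced w -> reduced (w ++ d)) -> all X u ->
  desc s (wd (u ++ d)) -> desc s (wd u).
Proof.
move=> Xs ru dmin Xu; apply: contraTT; rewrite -reduced_cons // => rsu.
have := dmin (s :: u); rewrite /= Xs Xu => /(_ isT rsu).
by rewrite reduced_cons // dmin.
Qed.

(** Putting t in front gives an alternating word of length k + 1 equal to one of length below k.
    This forces 2 m s t <= 2k, whereas reducedness gives k <= m s t. *)
Lemma desc_pair_alt s t k : s != t -> reduced (alt k s t) ->
  desc t (wd (alt k s t)) -> m s t = Some k.
Proof.
move=> st rk dt; have ts : t != s by rewrite eq_sym.
have dts : all (pred2 s t) (alt k.+1 t s).
  by apply: all_alt; rewrite /= eqxx ?orbT.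
have [v [Xv rv vE vk]] := parabolic_reduced hm dts.
have {}vk : (size v < k)%N.
  move: dt; rewrite /desc -wd_cons -altS -vE (eqP rv).
  by rewrite (eqP rk) size_alt.
have k0 : (0 < k.+1 + size v)%N by [].
have [ve|ve] := reduced_pair Xv rv.
  rewrite ve in vE; have [k1 mst k1le] := wd_alt_opposite ts k0 (esym vE).
  have := size_reduced_alt st _ rk; rewrite (cox_sym hm) mst => /(_ _ erefl) kk1.
  by congr Some; lia.
move: vE; rewrite {1}ve; case: (size v) vk => [|j] jk.
  move=> /esym h; have [k1 mst k1le] := @wd_alt_opposite t s k.+1 0 ts k0 h.
  have := size_reduced_alt st _ rk; rewrite (cox_sym hm) mst => /(_ _ erefl) kk1.
  by congr Some; lia.
rewrite !altS !wd_cons => /mulgI e.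
by have := wlen_le m (alt j s t); rewrite e (eqP rk) !size_alt; lia.
Qed.

(** Both descents pass to the component of g in the subgroup generated by s and t, where only a
    longest element has two descents. *)
Lemma desc2 s t g : s != t -> desc s g -> desc t g ->
  exists k d, [/\ m s t = Some k, reduced (alt k s t ++ d) & wd (alt k s t ++ d) = g].
Proof.
move=> st ds dt; have [u [d [Xu ru gE dmin]]] := coset_decomposition hm (pred2 s t) g.
move: ds dt; rewrite -gE => ds dt.
have {}ds : desc s (wd u) by apply: (desc_cat _ ru dmin Xu ds); rewrite /= eqxx.
have {}dt : desc t (wd u) by apply: (desc_cat _ ru dmin Xu dt); rewrite /= eqxx orbT.
have ts : t != s by rewrite eq_sym.
have [ue|ue] := reduced_pair Xu ru; exists (size u), d.
  rewrite -ue; split; [|exact: dmin|by []].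
  by apply: desc_pair_alt; rewrite // -ue.
have mts : m t s = Some (size u) by apply: desc_pair_alt; rewrite // -ue.
have mst : m s t = Some (size u) by rewrite (cox_sym hm).
have e : wd (alt (size u) s t) = wd u by rewrite [in RHS]ue; apply: wd_alt.
split=> //; last by rewrite !wd_cat e.
by rewrite (@reduced_wd _ _ _ (u ++ d)) ?dmin // ?wd_cat ?e // !size_cat size_alt.
Qed.

(** The hypotheses make p minimal in its right coset of the dihedral subgroup: a nontrivial
    component u would start with a descent s or t of the reverse of p. *)
Lemma reduced_cat_alt p s t k : s != t -> m s t = Some k ->
  reduced (rcons p s) -> reduced (rcons p t) -> reduced (p ++ alt k s t).
Proof.
move=> st mst rs rt.
have [u [d [Xu ru gE dmin]]] := coset_decomposition hm (pred2 s t) (wd (rev p)).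
have rp : reduced (rev p).
  by rewrite reduced_rev; apply: (@reduced_catl _ _ p [:: s]); rewrite cats1.
case: u Xu ru gE => [|a u] Xu ru gE.
  rewrite -reduced_rev rev_cat (@reduced_wd _ _ _ (rev (alt k s t) ++ d)).
  - apply: dmin; first by rewrite all_rev all_alt /= ?eqxx ?orbT.
    by rewrite reduced_rev (reduced_alt st mst).
  - by rewrite !wd_cat gE.
  have rd : reduced d by apply: (dmin [::]) => //; rewrite reducedE.
  by rewrite !size_cat -(eqP rd) -(eqP rp) -gE.
have : desc a (wd (rev p)).
  by rewrite -gE; apply: desc_cons; exact: (dmin (a :: u)).
suff : ~~ desc a (wd (rev p)) by move/negPf->.
have : pred2 s t a by case/andP: Xu.
by rewrite -reduced_cons // -rev_rcons reduced_rev => /pred2P[]->.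
Qed.

End Dihedral.

(** * The braid monoid *)

Section Braid.
Variables (S : finType) (m : S -> S -> option nat).
Hypothesis hm : coxeter_matrix m.
Local Notation W := (coxeter_group m).
Local Notation wd := (@wd S m).
Local Notation wgen := (@wgen S m).
Local Notation reduced := (@reduced S m).
Local Notation desc := (@desc S m).
Implicit Types (u v w a b c d p q y z : seq S) (s t r : S).

(** A chain of braid moves with its first move exposed, which suits inductions that follow the
    left-hand word; symmetry comes from that of the matrix. *)
Inductive beq : seq S -> seq S -> Prop :=
| beq_refl u : beq u u
| beq_step p q s t k v : s != t -> m s t = Some k ->
    beq (p ++ alt k t s ++ q) v -> beq (p ++ alt k s t ++ q) v.
Local Infix "~=" := beq (at level 70).

Lemma beq_trans u v w : u ~= v -> v ~= w -> u ~= w.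
Proof.
elim=> // p q s t k v' st mst _ IH vw; apply: beq_step st mst _; exact: IH.
Qed.

Lemma beq_alt p q s t k : m s t = Some k -> p ++ alt k s t ++ q ~= p ++ alt k t s ++ q.
Proof.
have [->|st mst] := eqVneq s t; first by move=> _; apply: beq_refl.
by apply: beq_step st mst _; apply: beq_refl.
Qed.

Lemma beq_sym u v : u ~= v -> v ~= u.
Proof.
elim=> [w|p q s t k v' st mst _ IH]; first exact: beq_refl.
by apply: beq_trans IH _; apply: beq_alt; rewrite (cox_sym hm).
Qed.

Lemma beq_ctx p q u v : u ~= v -> p ++ u ++ q ~= p ++ v ++ q.
Proof.
elim=> [w|p' q' s t k v' st mst _ IH]; first exact: beq_refl.
apply: beq_trans IH; have := beq_alt (p ++ p') (q' ++ q) mst.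
by rewrite -!catA.
Qed.

Lemma beq_catl p u v : u ~= v -> p ++ u ~= p ++ v.
Proof. by move/(beq_ctx p [::]); rewrite !cats0. Qed.

Lemma beq_catr q u v : u ~= v -> u ++ q ~= v ++ q.
Proof. exact: (beq_ctx [::] q). Qed.

Lemma beq_cons s u v : u ~= v -> s :: u ~= s :: v.
Proof. exact: (beq_catl [:: s]). Qed.

Lemma beq_cat u u' v v' : u ~= u' -> v ~= v' -> u ++ v ~= u' ++ v'.
Proof. by move=> uu vv; apply: beq_trans (beq_catr _ uu) (beq_catl _ vv). Qed.

Lemma beq_size u v : u ~= v -> size u = size v.
Proof. by elim=> // p q s t k v' _ _ _ <-; rewrite !size_cat !size_alt. Qed.

Lemma beq_wd u v : u ~= v -> wd u = wd v.
Proof. by elim=> // p q s t k v' _ mst _ <-; rewrite !wd_cat (wd_alt mst). Qed.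

Lemma all_alt2 (X : pred S) k s t : all X (alt k.+2 s t) = X s && X t.
Proof.
apply/idP/andP => [|[Xs Xt]]; last exact: all_alt.
by rewrite !altS /= => /and3P[-> ->].
Qed.

Lemma beq_all (X : pred S) u v : u ~= v -> all X u = all X v.
Proof.
elim=> // p q s t k v' st mst _ <-; rewrite !all_cat.
have := cox_ge2 hm st mst; case: k {mst} => [|[|k]] // _.
by rewrite !all_alt2 [X s && _]andbC.
Qed.

Lemma beq_reduced u v : u ~= v -> reduced u = reduced v.
Proof. by move=> uv; apply: reduced_wd; [apply: beq_wd|apply: beq_size]. Qed.

Lemma beq_rev u v : u ~= v -> rev u ~= rev v.
Proof.
elim=> [w|p q s t k v' st mst _ IH]; first exact: beq_refl.
apply: beq_trans IH; rewrite !rev_cat -!catA !rev_alt.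
by case: odd; apply: beq_alt => //; rewrite (cox_sym hm).
Qed.

(* Matsumoto's theorem. *)
Lemma reduced_beq u v : reduced u -> reduced v -> wd u = wd v -> u ~= v.
Proof.
have [n] := ubnP (size u); elim: n u v => // n IH u v un ru rv uv.
have suv : size u = size v by rewrite -(eqP ru) -(eqP rv) uv.
case: u v suv un ru rv uv => [|s u] [|t v] //; first by move=> *; apply: beq_refl.
move=> [suv] un rsu rtv; have ru := @reduced_catr _ m [:: s] u rsu.
have rv := @reduced_catr _ m [:: t] v rtv.
have [<-|st] := eqVneq s t.
  by rewrite !wd_cons => /mulgI uv; apply/beq_cons/IH.
move=> uv; have := desc_cons rtv; rewrite -uv => dt.
(* The element has descents s and t, so it has a reduced word through their lcm, to which both given
   words are linked by induction. *)
have [k [d [mst rkd kdE]]] := desc2 hm st (desc_cons rsu) dt.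
have := cox_ge2 hm st mst; case: k mst rkd kdE => [|k] // mst rkd kdE _.
have kdE' : wd (alt k.+1 t s ++ d) = wd (s :: u).
  by rewrite -kdE !wd_cat (wd_alt mst).
have rkd' : reduced (alt k.+1 t s ++ d).
  by rewrite -(@reduced_wd _ _ (alt k.+1 s t ++ d)) ?size_cat ?size_alt // kdE.
have e1 : u ~= alt k t s ++ d.
  apply: IH => //.
    by move: rkd; rewrite altS; apply: (@reduced_catr _ _ [:: s]).
  by move: kdE; rewrite altS /= !wd_cons => /mulgI.
have e2 : v ~= alt k s t ++ d.
  apply: IH => //; first by rewrite -suv.
    by move: rkd'; rewrite altS; apply: (@reduced_catr _ _ [:: t]).
  by move: kdE'; rewrite uv altS /= !wd_cons => /mulgI.
apply: beq_trans (beq_cons s e1) _; apply: beq_trans _ (beq_sym (beq_cons t e2)).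
by rewrite -!cat_cons -!altS; exact: (beq_alt [::] d mst).
Qed.

(* Left divisibility; right divisibility is expressed as [dvd (rev a) (rev y)]. *)
Definition dvd a y := exists z, y ~= a ++ z.

Lemma dvd_refl a : dvd a a.
Proof. by exists [::]; rewrite cats0; apply: beq_refl. Qed.

Lemma dvd0 y : dvd [::] y. Proof. by exists y; apply: beq_refl. Qed.

Lemma dvd_catr a b : dvd a (a ++ b).
Proof. by exists b; apply: beq_refl. Qed.

Lemma dvd_trans a b y : dvd a b -> dvd b y -> dvd a y.
Proof.
move=> [z bE] [x yE]; exists (z ++ x); apply: beq_trans yE _.
by rewrite catA; apply: beq_catr.
Qed.

Lemma dvd_beql a a' y : a ~= a' -> dvd a y -> dvd a' y.
Proof. by move=> aa [z yE]; exists z; apply: beq_trans yE (beq_catr _ aa). Qed.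

Lemma dvd_beqr a y y' : y ~= y' -> dvd a y -> dvd a y'.
Proof. by move=> /beq_sym yy [z yE]; exists z; apply: beq_trans yy yE. Qed.

Lemma dvd_cat2l p a y : dvd a y -> dvd (p ++ a) (p ++ y).
Proof. by move=> [z yE]; exists z; rewrite -catA; apply: beq_catl. Qed.

Lemma dvd_size a y : dvd a y -> (size a <= size y)%N.
Proof. by move=> [z /beq_size ->]; rewrite size_cat leq_addr. Qed.

(** Garside's key property, left cancellation of a letter and the lcm of two letters, for whole
    words of length at most n. *)
Definition first_letters n := forall u v s t, (size u < n)%N ->
  s :: u ~= t :: v ->
  if s == t then u ~= v else
  exists k z, [/\ m s t = Some k.+1, u ~= alt k t s ++ z & v ~= alt k s t ++ z].

Section Step.
Variable n : nat.
Hypothesis FL : first_letters n.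

Lemma step_cancel a u v : (size (a ++ u) <= n)%N -> a ++ u ~= a ++ v -> u ~= v.
Proof.
elim: a => //= s a IH an /(FL an); rewrite eqxx => /IH; apply; exact: ltnW.
Qed.

Lemma step_dvd_cat2l a b y : (size (a ++ y) <= n)%N -> dvd (a ++ b) (a ++ y) -> dvd b y.
Proof. by move=> an [z]; rewrite -catA => /(step_cancel an) yE; exists z. Qed.

(* Induction on y: p collects the letters already removed, and the join of
   s :: a and t :: b is obtained from three smaller joins along the lcm of s and t. *)
Lemma simple_join p a b y : (size y <= n)%N -> reduced (p ++ a) -> reduced (p ++ b) ->
  dvd a y -> dvd b y ->
  exists c, [/\ reduced (p ++ c), dvd a c, dvd b c & dvd c y].
Proof.
have [N] := ubnP (size y); elim: N p a b y => // N IH p a b y yN yn.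
case: a => [_ rb _ dby|s a]; first by exists b; split=> //; [apply: dvd0|apply: dvd_refl].
case: b => [ra _ day _|t b]; first by exists (s :: a); split=> //; [apply: dvd_refl|apply: dvd0].
rewrite -[p ++ s :: a]cat_rcons -[p ++ t :: b]cat_rcons => ra rb.
move=> [z1 yE1] [z2 yE2].
have sy1 := beq_size yE1; have sy2 := beq_size yE2; rewrite /= in sy1 sy2.
have e12 := beq_trans (beq_sym yE1) yE2; rewrite !cat_cons in e12.
have lt1 : (size (a ++ z1) < n)%N by rewrite -sy1.
have := FL lt1 e12; case: eqP => [st|/eqP st]; last first.
  move=> [k [z [mst e1 e2]]].
  have rsk : reduced (rcons p s ++ alt k t s).
    rewrite cat_rcons -altS; apply: (reduced_cat_alt hm st mst).
      exact: reduced_catl ra.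
    exact: reduced_catl rb.
  have rtk : reduced (rcons p t ++ alt k s t).
    rewrite cat_rcons -altS (@reduced_wd _ _ _ (rcons p s ++ alt k t s)) //.
      by rewrite cat_rcons -altS !wd_cat (wd_alt mst).
    by rewrite !size_cat size_rcons !size_alt addSnnS.
  have sN1 : (size (a ++ z1) < N)%N by rewrite -ltnS -sy1.
  have sN2 : (size (b ++ z2) < N)%N by rewrite -ltnS -sy2.
  have sn2 : (size (b ++ z2) <= n)%N by rewrite ltnW // -sy2.
  have k1y : dvd (alt k t s) (a ++ z1) by exists z.
  have k2y : dvd (alt k s t) (b ++ z2) by exists z.
  have [c1 [rc1 ac1 [d1 c1E] c1y]] :=
    IH (rcons p s) _ _ _ sN1 (ltnW lt1) ra rsk (dvd_catr a z1) k1y.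
  have [c2 [rc2 bc2 [d2 c2E] c2y]] :=
    IH (rcons p t) _ _ _ sN2 sn2 rb rtk (dvd_catr b z2) k2y.
  have kz1 : (size (alt k t s ++ z) < n)%N by rewrite -(beq_size e1).
  have kz2 : (size (alt k s t ++ z) < n)%N by rewrite -(beq_size e2) -sy2.
  have d1z : dvd d1 z.
    apply: (step_dvd_cat2l (ltnW kz1)); apply: dvd_beql c1E _; exact: dvd_beqr c1y.
  have d2z : dvd d2 z.
    apply: (step_dvd_cat2l (ltnW kz2)); apply: dvd_beql c2E _; exact: dvd_beqr c2y.
  have rd1 : reduced ((p ++ alt k.+1 s t) ++ d1).
    by rewrite altS -catA cat_cons -cat_rcons -(beq_reduced (beq_catl _ c1E)).
  have rd2 : reduced ((p ++ alt k.+1 s t) ++ d2).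
    rewrite -catA (beq_reduced (beq_alt p d2 mst)) altS cat_cons -cat_rcons.
    by rewrite -(beq_reduced (beq_catl _ c2E)).
  have zs : (size z <= size (a ++ z1))%N by rewrite (beq_size e1) size_cat leq_addl.
  have [d [rd d1d d2d dz]] := IH (p ++ alt k.+1 s t) d1 d2 z
    (leq_ltn_trans zs sN1) (leq_trans zs (ltnW lt1)) rd1 rd2 d1z d2z.
  exists (alt k.+1 s t ++ d); split; first by rewrite catA.
  - rewrite altS; apply: (@dvd_cat2l [:: s]); apply: dvd_trans ac1 _.
    by apply: dvd_beql (beq_sym c1E) _; apply: dvd_cat2l.
  - apply: dvd_beqr (beq_sym (beq_alt [::] d mst)) _; rewrite altS.
    apply: (@dvd_cat2l [:: t]); apply: dvd_trans bc2 _.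
    by apply: dvd_beql (beq_sym c2E) _; apply: dvd_cat2l.
  apply: dvd_beqr (beq_sym yE1) _; rewrite altS; apply: (@dvd_cat2l [:: s]).
  by apply: dvd_beqr (beq_sym e1) _; apply: dvd_cat2l.
rewrite -st in yE2 e12 rb *; move=> az.
have sN1 : (size (a ++ z1) < N)%N by rewrite -ltnS -sy1.
have bz : dvd b (a ++ z1) by exists z2.
have [c [rc ac bc cy]] := IH (rcons p s) _ _ _ sN1 (ltnW lt1) ra rb (dvd_catr a z1) bz.
exists (s :: c); split; first by rewrite -cat_rcons.
- exact: (@dvd_cat2l [:: s]).
- exact: (@dvd_cat2l [:: s]).
by apply: dvd_beqr (beq_sym yE1) _; apply: (@dvd_cat2l [:: s]).
Qed.

End Step.

(* The cube condition for three letters: r :: y is divisible by s and t by way of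
   the simple elements alt k.+1 r s and alt j.+1 r t, which by [simple_join] have a
   simple common multiple r :: c dividing it; s and t being descents of r :: c,
   it is also a multiple of their lcm. *)
Lemma cube_condition n r s t k j zs zt y : first_letters n -> (size y <= n)%N ->
  r != s -> r != t -> s != t -> m r s = Some k.+1 -> m r t = Some j.+1 ->
  y ~= alt k s r ++ zs -> y ~= alt j t r ++ zt ->
  exists i z, [/\ m s t = Some i.+1, alt k r s ++ zs ~= alt i t s ++ z
    & alt j r t ++ zt ~= alt i s t ++ z].
Proof.
move=> FL yn rs rt st mrs mrt ys yt.
have rks : reduced ([:: r] ++ alt k s r).
  by rewrite cat1s -altS; apply: (reduced_alt hm rs mrs).
have rjt : reduced ([:: r] ++ alt j t r).
  by rewrite cat1s -altS; apply: (reduced_alt hm rt mrt).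
have [c [rc [c1 c1E] [c2 c2E] [e yE]]] := simple_join FL yn rks rjt
  (ex_intro _ _ ys) (ex_intro _ _ yt).
have zsE : zs ~= c1 ++ e.
  apply: (step_cancel FL (a := alt k s r)); first by rewrite -(beq_size ys).
  by apply: beq_trans (beq_sym ys) _; apply: beq_trans yE _; rewrite catA; apply: beq_catr.
have ztE : zt ~= c2 ++ e.
  apply: (step_cancel FL (a := alt j t r)); first by rewrite -(beq_size yt).
  by apply: beq_trans (beq_sym yt) _; apply: beq_trans yE _; rewrite catA; apply: beq_catr.
have rcs : r :: c ~= s :: alt k r s ++ c1.
  apply: beq_trans (beq_cons r c1E) _.
  by rewrite -!cat_cons -!altS; exact: (beq_alt [::] c1 mrs).
have rct : r :: c ~= t :: alt j r t ++ c2.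
  apply: beq_trans (beq_cons r c2E) _.
  by rewrite -!cat_cons -!altS; exact: (beq_alt [::] c2 mrt).
have rs1 : reduced (s :: alt k r s ++ c1) by rewrite -(beq_reduced rcs).
have rt1 : reduced (t :: alt j r t ++ c2) by rewrite -(beq_reduced rct).
have ds := desc_cons rs1; have dt := desc_cons rt1.
rewrite -(beq_wd rcs) in ds; rewrite -(beq_wd rct) in dt.
have [i [z [mst rz zE]]] := desc2 hm st ds dt.
have := cox_ge2 hm st mst; case: i mst rz zE => [|i] // mst rz zE _.
have rz' : reduced (alt i.+1 t s ++ z) by rewrite -(beq_reduced (beq_alt [::] z mst)).
have zE' : wd (alt i.+1 t s ++ z) = wd (r :: c) by rewrite -(beq_wd (beq_alt [::] z mst)).
exists i, (z ++ e); split=> //.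
  apply: beq_trans (beq_catl _ zsE) _; rewrite !catA; apply: beq_catr.
  apply: reduced_beq; first by apply: (@reduced_catr _ _ [:: s]).
    by move: rz; rewrite altS; apply: (@reduced_catr _ _ [:: s]).
  by move: zE; rewrite (beq_wd rcs) altS cat_cons !wd_cons => /mulgI.
apply: beq_trans (beq_catl _ ztE) _; rewrite !catA; apply: beq_catr.
apply: reduced_beq; first by apply: (@reduced_catr _ _ [:: t]).
  by move: rz'; rewrite altS; apply: (@reduced_catr _ _ [:: t]).
by move: zE'; rewrite (beq_wd rct) altS cat_cons !wd_cons => /mulgI.
Qed.

(** Inner induction on the chain of braid moves. A move that leaves the first letter alone only
    changes u. A move at the front replaces s by b, and the cube condition composes the relation
    between s and b with the one between b and t; if t = s, both pass through the same lcm, which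
    cancels. *)
Lemma first_lettersP n : first_letters n.
Proof.
elim/ltn_ind: n => n IHn u v s t un suv.
have {IHn un} FL : first_letters (size u) by apply: IHn.
move ux: (s :: u) suv => x; move vy: (t :: v) => y xy.
elim: xy u v s t ux vy FL => {x y} [x|p q a b k y ab mab xy IH] u v s t ux vy FL.
  by move: vy; rewrite -ux => -[-> ->]; rewrite eqxx; apply: beq_refl.
case: p ux xy IH => [|c p] ux xy IH; last first.
  move: ux => /= [sc uE]; rewrite -sc in IH xy *.
  have uu : u ~= p ++ alt k b a ++ q by rewrite uE; apply: beq_alt.
  have FL' : first_letters (size (p ++ alt k b a ++ q)) by rewrite -(beq_size uu).
  have := IH (p ++ alt k b a ++ q) v s t erefl vy FL'.
  case: eqP => _; first exact: beq_trans.
  by move=> [i [z [? e1 e2]]]; exists i, z; split=> //; apply: beq_trans e1.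
have := cox_ge2 hm ab mab; case: k mab ux xy IH => [|k] // mab ux xy IH _.
move: ux; rewrite cat0s altS cat_cons => -[sa uE].
rewrite -sa in mab ab uE IH xy *; rewrite uE.
have su : size u = size (alt k s b ++ q) by rewrite uE !size_cat !size_alt.
have FL' : first_letters (size (alt k s b ++ q)) by rewrite -su.
have mbs : m b s = Some k.+1 by rewrite (cox_sym hm).
have bs : b != s by rewrite eq_sym.
have := IH (alt k s b ++ q) v b t _ vy FL'; rewrite cat0s altS => /(_ erefl).
have [<- yE|bt] := eqVneq b t.
  rewrite (negPf ab); exists k, q; split=> //; first exact: beq_refl.
  exact: beq_sym.
move=> [j [zt [mbt yE vE]]]; have [st|st] := eqVneq s t; last first.
  have [i [z [mst e1 e2]]] :=
    cube_condition FL' (leqnn _) bs bt st mbs mbt (beq_refl _) yE.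
  by exists i, z; split=> //; apply: beq_trans vE e2.
rewrite -st in mbt yE vE; move: mbt; rewrite mbs => -[kj]; rewrite -kj in yE vE.
apply: beq_trans _ (beq_sym vE); apply: beq_catl.
exact: (step_cancel FL' (leqnn _) yE).
Qed.

End Braid.

(** * Least common multiples and fundamental elements *)

Section Garside.
Variables (S : finType) (m : S -> S -> option nat).
Hypothesis hm : coxeter_matrix m.
Local Notation W := (coxeter_group m).
Local Notation wd := (@wd S m).
Local Notation wgen := (@wgen S m).
Local Notation reduced := (@reduced S m).
Local Notation desc := (@desc S m).
Local Notation dvd := (@dvd S m).
Local Infix "~=" := (@beq S m) (at level 70).
Implicit Types (u v w a b c d p q y z h : seq S) (s t r x : S) (X : pred S).
Local Notation brefl := (beq_refl m _).
Local Notation bsym := (beq_sym hm).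

Lemma beq_first u v s t : s :: u ~= t :: v ->
  if s == t then u ~= v else
  exists k z, [/\ m s t = Some k.+1, u ~= alt k t s ++ z & v ~= alt k s t ++ z].
Proof. exact: (first_lettersP hm (ltnSn (size u))). Qed.

Lemma beq_cancel a u v : a ++ u ~= a ++ v -> u ~= v.
Proof.
exact: (step_cancel (first_lettersP hm (n := size (a ++ u))) (leqnn _)).
Qed.

Lemma beq_cancelr a u v : u ++ a ~= v ++ a -> u ~= v.
Proof.
move=> /(beq_rev hm); rewrite !rev_cat => /beq_cancel /(beq_rev hm).
by rewrite !revK.
Qed.

Lemma dvd_cancel a b y : dvd (a ++ b) (a ++ y) -> dvd b y.
Proof. by move=> [z]; rewrite -catA => /beq_cancel yE; exists z. Qed.

Lemma dvd_same_size a y : dvd a y -> (size y <= size a)%N -> y ~= a.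
Proof.
move=> [z yE]; rewrite (beq_size yE) size_cat.
by case: z yE => [|x z]; [rewrite cats0|rewrite /=; lia].
Qed.

Lemma dvd_alt s t y : s != t -> dvd [:: s] y -> dvd [:: t] y ->
  exists2 k, m s t = Some k & dvd (alt k s t) y.
Proof.
move=> st [z1 y1] [z2 y2]; have := beq_first (beq_trans (bsym y1) y2).
rewrite (negPf st) => -[k [z [mst e1 e2]]]; exists k.+1 => //.
by exists z; apply: beq_trans y1 _; rewrite altS; apply: (beq_cons s e1).
Qed.

(** Word reversing: c p is the lcm of b and c. The common multiple c h bounds the recursion, and p
    stays over X because the lcm of two letters involves only these letters. *)
Lemma lcm_complement X c b h : all X c -> all X b -> dvd b (c ++ h) ->
  exists p, [/\ all X p, dvd b (c ++ p) & forall h', dvd b (c ++ h') -> dvd p h'].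
Proof.
have [N] := ubnP (size (c ++ h)); elim: N b c h => // N IH b c h lN Xc Xb.
case: b Xb => [_ _|x b Xb].
  by exists [::]; split=> // [|h' _]; apply: dvd0.
case: c Xc lN => [_ _ _|y c Xc lN].
  by exists (x :: b); split=> //; apply: dvd_refl.
have [Xx Xb'] : X x /\ all X b by apply/andP.
have [Xy Xc'] : X y /\ all X c by apply/andP.
move=> [z E]; rewrite !cat_cons in E; have := beq_first E; have [yx|yx] := eqVneq y x.
  move=> e; have [p [Xp bcp puniv]] := IH b c h lN Xc' Xb' (ex_intro _ z e).
  exists p; split=> //; rewrite yx; first exact: (@dvd_cat2l _ m [:: x]).
  by move=> h' /(@dvd_cancel [:: x])/puniv.
move=> [k [z0 [myx e1 e2]]].
have Xq : all X (alt k x y) by apply: all_alt.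
(* The diagram has two tiles: p1 completes c to a multiple of the remainder of lcm(x, y) after y,
   and p2 below completes the resulting remainder after x to a multiple of b. *)
have [p1 [Xp1 [r1 r1E] p1univ]] := IH (alt k x y) c h lN Xc' Xq (ex_intro _ _ e1).
have transfer h' z' : c ++ h' ~= alt k x y ++ z' ->
    exists2 h1, h' ~= p1 ++ h1 & z' ~= r1 ++ h1.
  move=> e; have [h1 h1E] := p1univ h' (ex_intro _ _ e); exists h1 => //.
  apply: (@beq_cancel (alt k x y)); apply: beq_trans (bsym e) _.
  by apply: beq_trans (beq_catl _ h1E) _; rewrite !catA; apply: beq_catr.
have [h1 hE z0E] := transfer _ _ e1.
have Xr1 : all X r1.
  by have := beq_all hm X r1E; rewrite !all_cat Xc' Xp1 Xq /=.
have Xqr : all X (alt k y x ++ r1) by rewrite all_cat all_alt.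
have e3 : (alt k y x ++ r1) ++ h1 ~= b ++ z.
  by apply: bsym; apply: beq_trans e2 _; rewrite -catA; apply: beq_catl.
have lN' : (size ((alt k y x ++ r1) ++ h1) < N)%N.
  by have := beq_size E; rewrite (beq_size e3) => -[<-].
have [p2 [Xp2 bqp p2univ]] := IH b _ h1 lN' Xqr Xb' (ex_intro _ _ e3).
exists (p1 ++ p2); split; first by rewrite all_cat Xp1.
  have e4 : (y :: c) ++ p1 ++ p2 ~= x :: (alt k y x ++ r1) ++ p2.
    rewrite cat_cons catA; apply: beq_trans (beq_cons y (beq_catr p2 r1E)) _.
    rewrite -!catA -!cat_cons -!altS; exact: (beq_alt [::] _ myx).
  exact (dvd_beqr hm (bsym e4) (@dvd_cat2l _ m [:: x] _ _ bqp)).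
move=> h' [z' E']; rewrite !cat_cons in E'; have := beq_first E'; rewrite (negPf yx).
move=> [k' [z1 []]]; rewrite myx => -[<-] e5 e6.
have [h2 h'E z1E] := transfer _ _ e5.
have bh : dvd b ((alt k y x ++ r1) ++ h2).
  exists z'; apply: bsym; apply: beq_trans e6 _; rewrite -catA.
  exact: beq_catl.
by apply: (dvd_beqr hm (bsym h'E) _); apply: dvd_cat2l; apply: p2univ.
Qed.

Lemma desc_dvd s u : reduced u -> desc s (wd u) -> dvd [:: s] u.
Proof.
move=> ru /desc_word[u' ru' e]; exists u'.
by apply: (reduced_beq hm).
Qed.

(** For u = p t s, write p t = d' w' with w' over {s, t} and d' minimal in its coset; w' is not
    empty, so d' s and d' t are shorter than u and divide y by induction. Then y is a multiple of d'
    lcm(s, t), and the reduced word w' s is, up to braid moves, a prefix of that lcm. *)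
Lemma reduced_dvd X y u : (forall x, X x -> dvd [:: x] y) ->
  all X u -> reduced u -> dvd u y.
Proof.
move=> Xy; have [n] := ubnP (size u); elim: n u => // n IH u.
case/lastP: u => [_ _ _|p s]; first exact: dvd0.
case/lastP: p => [_ Xs _|p t]; first by apply: Xy; case/andP: Xs.
rewrite ltnS [size (rcons _ s)]size_rcons => un Xu ru.
have /andP[Xs Xp] : X s && all X (rcons p t) by rewrite -all_rcons.
have /andP[Xt _] : X t && all X p by rewrite -all_rcons.
have rp : reduced (rcons p t) by move: ru; rewrite -cats1; apply: reduced_catl.
have st : s != t.
  apply: contraL ru => /eqP ->; rewrite reducedE !wd_rcons wgenKr -ltnNge.
  by apply: leq_ltn_trans (wlen_le _ _) _; rewrite !size_rcons.
have [w [d [Xw rw wdE dmin]]] := coset_decomposition hm (pred2 s t) (wd (rev (rcons p t))).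
have pE : rcons p t ~= rev d ++ rev w.
  apply: (reduced_beq hm) => //; first by rewrite -rev_cat reduced_rev; apply: dmin.
  by rewrite -rev_cat wd_rev wdE wd_rev invgK.
have dw : (size d < size (rcons p t))%N.
  rewrite (beq_size pE) size_cat !size_rev -[X in (X < _)%N]addn0 ltn_add2l.
  case: w Xw rw wdE {pE} => // _ _ wdE.
  have rtp : reduced (t :: rev p) by rewrite -rev_rcons reduced_rev.
  have := desc_cons rtp; rewrite -rev_rcons -wdE cat0s -[desc _ _]negbK.
  have rd : reduced d by apply: (dmin [::]); rewrite // reducedE.
  rewrite -reduced_cons // (dmin [:: t]) //= ?eqxx ?orbT //.
  by rewrite /reduced wd1 wlen1.
have Xd : all X (rev d).
  by have := beq_all hm X pE; rewrite Xp all_cat => /esym/andP[].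
have step x : pred2 s t x -> X x -> dvd (rcons (rev d) x) y.
  move=> stx Xx; apply: IH.
  - by rewrite size_rcons size_rev; apply: leq_ltn_trans dw _.
  - by rewrite all_rcons Xx.
  rewrite -rev_cons reduced_rev; apply: (dmin [:: x]); first by move: stx => /= ->.
  by rewrite /reduced wd1 wlen1.
have ss : pred2 s t s by rewrite /= eqxx.
have [y1 y1E] := step s ss Xs.
have dt : dvd (rcons (rev d) t) y by apply: step; rewrite //= eqxx orbT.
rewrite cat_rcons in y1E.
have {}dt : dvd [:: t] (s :: y1).
  apply: (@dvd_cancel (rev d)); rewrite cats1; exact: (dvd_beqr hm y1E dt).
have [k mst ky] := dvd_alt st (dvd_catr m [:: s] y1) dt.
have uE : rcons (rcons p t) s ~= rev d ++ rcons (rev w) s.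
  by rewrite -!cats1 catA; apply: beq_catr; rewrite cats1.
apply: dvd_beql (bsym uE) _; apply: (dvd_beqr hm (bsym y1E) _); apply: dvd_cat2l.
have rws : reduced (rcons (rev w) s).
  by move: ru; rewrite (beq_reduced uE); apply: reduced_catr.
have Xws : all (pred2 s t) (rcons (rev w) s).
  by rewrite all_rcons all_rev Xw /= eqxx.
have mts : m t s = Some k by rewrite (cox_sym hm).
have ts : t != s by rewrite eq_sym.
apply: dvd_trans ky; have [e|e] := reduced_pair Xws rws; rewrite e.
  have jk : (size (rcons (rev w) s) <= k)%N.
    by apply: (size_reduced_alt hm st mst); rewrite -e.
  by rewrite -(subnKC jk) alt_cat; apply: dvd_catr.
have jk : (size (rcons (rev w) s) <= k)%N.
  by apply: (size_reduced_alt hm ts mts); rewrite -e.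
have e' : alt k t s ~= alt k s t by have := beq_alt [::] [::] mts; rewrite !cats0.
apply: (dvd_beqr hm e').
by rewrite -(subnKC jk) alt_cat; apply: dvd_catr.
Qed.

Lemma right_reduced_dvd X y u : (forall x, X x -> dvd [:: x] (rev y)) ->
  all X u -> reduced u -> dvd (rev u) (rev y).
Proof. by move=> Xy Xu ru; apply: (reduced_dvd Xy); rewrite ?all_rev ?reduced_rev. Qed.

Lemma dvd_rev a y : dvd (rev a) (rev y) <-> exists z, y ~= z ++ a.
Proof.
split=> [[z /(beq_rev hm)]|[z /(beq_rev hm)]].
  by rewrite rev_cat !revK => ?; exists (rev z).
by rewrite rev_cat => ?; exists (rev z).
Qed.

(** A word for the longest element of the parabolic subgroup of X in the Coxeter group. *)
Definition is_fundamental X D :=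
  [/\ all X D, reduced D, forall x, X x -> dvd [:: x] D
    & forall x, X x -> dvd [:: x] (rev D)].

Lemma fundamental_rdvd X D u : is_fundamental X D -> all X u -> reduced u ->
  exists z, D ~= z ++ u.
Proof. by case=> _ _ _ XD Xu ru; apply/dvd_rev/(right_reduced_dvd XD). Qed.

(** Write D = d x. Some t in X is not a descent of d, or else D would divide the shorter d. Then t d
    is reduced, divides D and has the same length, so D = t d and D x = t d x = t D. *)
Lemma fundamental_conj X D x : is_fundamental X D -> X x ->
  exists2 t, X t & rcons D x ~= t :: D.
Proof.
move=> FD Xx; have [XD rD _ /(_ x Xx)] := FD; rewrite -[[:: x]]/(rev [:: x]).
move=> /dvd_rev[d dE]; have rdx : reduced (d ++ [:: x]) by rewrite -(beq_reduced dE).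
have rd := reduced_catl rdx.
have Xd : all X d by have := beq_all hm X dE; rewrite XD all_cat => /esym/andP[].
have [t /andP[Xt td]] : exists t, X t && ~~ desc t (wd d).
  apply/existsP; apply: contraT; rewrite negb_exists => /forallP h.
  have /dvd_size : dvd D d.
    apply: (reduced_dvd (X := X)) => // t Xt; apply: desc_dvd => //.
    by have := h t; rewrite Xt negbK.
  by rewrite (beq_size dE) size_cat addn1 ltnn.
rewrite -reduced_cons // in td.
have Xtd : all X (t :: d) by rewrite /= Xt.
have [z zE] := fundamental_rdvd FD Xtd td.
have DE : D ~= t :: d.
  have := beq_size zE; rewrite (beq_size dE) !size_cat /= addn1.
  by case: z zE => //= a z _; lia.
exists t => //; rewrite -cats1; apply: beq_trans (beq_catr [:: x] DE) _.
by rewrite cat_cons; apply: beq_cons; apply: bsym.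
Qed.

(** * Existence of fundamental and central elements; the monoid embeds in the group *)

Section Spherical.
Hypothesis hsph : spherical_type m.

Lemma wlen_bounded : exists B, forall g : W, (wlen g <= B)%N.
Proof.
have /finite_seqP[s sW] : finite_set [set: W]%classic := hsph.
exists (\max_(g <- s) wlen g) => g.
have gs : g \in s by have : [set: W]%classic g by []; rewrite sW.
by rewrite (big_rem g) //= leq_maxl.
Qed.

Lemma fundamental_exists X : exists D, is_fundamental X D.
Proof.
have [B wB] := wlen_bounded.
pose P n := `[< exists u, [/\ all X u, reduced u & size u = n] >].
have exP : exists n, P n.
  by exists 0%N; apply/asboolP; exists [::]; rewrite reducedE.
have PB n : P n -> (n <= B)%N.
  by move=> /asboolP[u [_ /eqP ru <-]]; rewrite -ru.
have [n /asboolP[u [Xu ru un]] umax] := ex_maxnP exP PB.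
have main v : all X v -> reduced v -> size v = n -> forall x, X x -> dvd [:: x] v.
  move=> Xv rv vn x Xx; apply: desc_dvd => //; rewrite -[desc _ _]negbK -reduced_cons //.
  apply/negP => rxv; suff : (n < n)%N by rewrite ltnn.
  by apply: umax; apply/asboolP; exists (x :: v); rewrite /= Xx vn.
by exists u; split=> //; apply: main; rewrite ?all_rev ?reduced_rev ?size_rev.
Qed.

Lemma rcons_iter (f : S -> S) (D : seq S) n x : (forall x, rcons D x ~= f x :: D) ->
  flatten (nseq n D) ++ [:: x] ~= iter n f x :: flatten (nseq n D).
Proof.
move=> fE; elim: n => [|n IH] //=; first exact: brefl.
rewrite -catA; apply: beq_trans (beq_catl D IH) _.
by rewrite -cat_rcons; apply: (beq_catr _ (fE _)).
Qed.

Lemma central_exists : exists C,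
  (forall x, C ++ [:: x] ~= x :: C) /\ forall x, dvd [:: x] C.
Proof.
have [D FD] := fundamental_exists predT.
have /choice[f fE] : forall x, exists t, rcons D x ~= t :: D.
  by move=> x; have [t _ ?] := fundamental_conj FD (x := x) isT; exists t.
have finj : injective f.
  move=> x y fxy; have := fE y; rewrite -fxy => /bsym/(beq_trans (fE x)).
  rewrite -!cats1 => /beq_cancel /beq_first.
  have [//|xy [k [z [mxy e _]]]] := eqVneq x y.
  by have := beq_size e; have := cox_ge2 hm xy mxy; rewrite /= size_cat size_alt; lia.
(* D permutes the letters through f; the product of all orbit lengths is a common period, so D^N is
   central. *)
pose N := (\prod_(x : S) fingraph.order f x)%N.
have N0 : (0 < N)%N by apply: prodn_gt0 => x; apply: order_gt0.
have fN x : iter N f x = x.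
  rewrite /N (bigD1 x) //= mulnC iterM iter_fix //; exact: iter_order.
exists (flatten (nseq N D)); split=> x.
  by have := rcons_iter N x fE; rewrite fN.
case: N N0 {fN} => // n _; apply: dvd_trans (dvd_catr m D _).
by case: FD => _ _ + _; apply.
Qed.

(* The elements of the group are fractions with central denominators: a signed
   word is turned into a positive one by replacing each s^-1 by a complement of s
   in a central element C, at the cost of a factor C^-1. *)
Lemma pres_eq_beq u v : pres_eq (braid_rel m) (posw u) (posw v) -> u ~= v.
Proof.
have [C [Ccent Cdvd]] := central_exists.
have /choice[f fE] : forall x, exists z, C ~= x :: z.
  by move=> x; have [z zE] := Cdvd x; exists z.
have fE' x : C ~= f x ++ [:: x].
  apply: (@beq_cancel [:: x]); apply: beq_trans (bsym (Ccent x)) _.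
  exact: (beq_catr [:: x] (fE x)).
have Cw w : C ++ w ~= w ++ C.
  elim: w => [|x w IH]; first by rewrite cats0; apply: brefl.
  rewrite -cat1s catA; apply: beq_trans (beq_catr w (Ccent x)) _.
  exact: (beq_cons x IH).
pose Cn n := flatten (nseq n C).
have Cnw n w : Cn n ++ w ~= w ++ Cn n.
  elim: n => [|n IH]; first by rewrite cats0; apply: brefl.
  rewrite /Cn /= -catA; apply: beq_trans (beq_catl C IH) _.
  by rewrite !catA; apply: beq_catr.
have CnD n k : Cn (n + k)%N = Cn n ++ Cn k by rewrite /Cn nseqD flatten_cat.
pose P (w : word S) := flatten [seq (if l.2 then f l.1 else [:: l.1]) | l <- w].
have Pcat (w w' : word S) : P (w ++ w') = P w ++ P w' by rewrite /P map_cat flatten_cat.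
have Ppos w : P (posw w) = w by rewrite /P -map_comp /=; elim: w => //= x w {2}<-.
have npos w : negl (posw w) = 0%N by rewrite /negl count_map; elim: w.
have nalt k s t : negl (alternating k s t) = 0%N by apply: npos.
have neglD (w w' : word S) : negl (w ++ w') = (negl w + negl w')%N.
  by rewrite /negl count_cat.
(* Equality of the fractions [P w] / C^([negl w]), with the denominators cleared. *)
suff main (w w' : word S) : pres_eq (braid_rel m) w w' ->
    P w ++ Cn (negl w') ~= P w' ++ Cn (negl w).
  by move=> /main; rewrite !Ppos !npos /= !cats0.
elim=> {u v w w'} [u v s b|u v r1 r2 [s [t [k [st mst -> ->]]]]|u|u v _ IH|u v w _ IH1 _ IH2].
- have -> : negl (u ++ [:: (s, b); (s, ~~ b)] ++ v) = (negl (u ++ v) + 1)%N.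
    by rewrite /negl !count_cat /=; case: b => /=; lia.
  have : P [:: (s, b); (s, ~~ b)] ~= C.
    by case: b => /=; rewrite /P /= ?cats0; apply: bsym.
  rewrite addnC CnD !Pcat; move: (P [:: (s, b); (s, ~~ b)]) => w wC.
  rewrite -!catA; apply: beq_catl; apply: beq_trans (beq_catr _ wC) _.
  rewrite /Cn /= ?cats0 ?cat0s !catA; apply: beq_catr; exact: Cw.
- have -> : negl (u ++ alternating k s t ++ v) = negl (u ++ alternating k t s ++ v).
    by rewrite !neglD !nalt.
  by apply: beq_catr; rewrite !Pcat !Ppos; apply: beq_alt.
- exact: brefl.
- exact: bsym.
apply: (@beq_cancelr (Cn (negl v))); rewrite -!catA.
have sw n k : Cn n ++ Cn k = Cn k ++ Cn n by rewrite -!CnD addnC.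
rewrite sw [Cn (negl u) ++ _]sw; apply: beq_trans (beq_trans _ _).
- by rewrite catA; apply: beq_catr IH1.
- rewrite -catA sw catA; apply: beq_catr IH2.
by rewrite -!catA sw; apply: brefl.
Qed.

End Spherical.

End Garside.

(** * Conjugating powers of fundamental elements *)

Section Ribbons.
Variables (S : finType) (m : S -> S -> option nat).
Hypothesis hm : coxeter_matrix m.
Hypothesis hsph : spherical_type m.
Local Notation dvd := (@dvd S m).
Local Infix "~=" := (@beq S m) (at level 70).
Implicit Types (u v w a b c d h D : seq S) (s t x : S) (X Y : pred S).
Local Notation brefl := (beq_refl m _).
Local Notation bsym := (beq_sym hm).
Local Notation fundamental := (@is_fundamental S m).

Definition wpow D n := flatten (nseq n D).

Lemma wpowD D n k : wpow D (n + k) = wpow D n ++ wpow D k.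
Proof. by rewrite /wpow nseqD flatten_cat. Qed.

Lemma wpowSr D n : wpow D n.+1 = wpow D n ++ D.
Proof. by rewrite -addn1 wpowD /wpow /= cats0. Qed.

Lemma all_wpow X D n : all X D -> all X (wpow D n).
Proof. by move=> XD; elim: n => //= n IH; rewrite all_cat XD. Qed.

Definition lreduced X h := forall x, X x -> ~ dvd [:: x] h.
Definition rreduced X h := lreduced X (rev h).

Lemma lreduced_split X g : exists y h, [/\ all X y, lreduced X h & g ~= y ++ h].
Proof.
have [n] := ubnP (size g); elim: n g => // n IH g gn.
have [[x [Xx [z zE]]]|nx] := pselect (exists x, X x /\ dvd [:: x] g); last first.
  exists [::], g; split=> //; last exact: brefl.
  by move=> x Xx xg; apply: nx; exists x.
have [|y [h [Xy hr hE]]] := IH z; first by move: gn; rewrite (beq_size zE).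
exists (x :: y), h; split=> //; first by rewrite /= Xx.
by apply: beq_trans zE _; apply: (beq_cons x hE).
Qed.

Lemma rreduced_split X g : exists h z, [/\ rreduced X h, all X z & g ~= h ++ z].
Proof.
have [y [h [Xy hr hE]]] := lreduced_split X (rev g).
exists (rev h), (rev y); split; rewrite ?all_rev // /rreduced ?revK //.
by have := beq_rev hm hE; rewrite revK rev_cat.
Qed.

(** The complement of b after c is a word over X that divides h on the left, so it is empty and b
    already divides c. *)
Lemma lreduced_quotient X b c h h' : lreduced X h -> all X b -> all X c ->
  b ++ h' ~= c ++ h -> exists2 a, all X a & c ~= b ++ a.
Proof.
move=> hr Xb Xc E; have bch : dvd b (c ++ h) by exists h'; apply: bsym.
have [[|x p] [Xp bcp /(_ h bch) ph]] := lcm_complement hm Xc Xb bch; last first.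
  case: (hr x); first by case/andP: Xp.
  by apply: dvd_trans ph; apply: (dvd_catr m [:: x]).
rewrite cats0 in bcp; have [a aE] := bcp; exists a => //.
by have := beq_all hm X aE; rewrite Xc all_cat => /esym/andP[].
Qed.

Lemma fundamental_rev X D : fundamental X D -> fundamental X (rev D).
Proof. by case=> *; split; rewrite ?all_rev ?reduced_rev ?revK. Qed.

Lemma fundamental_lconj X D x : fundamental X D -> X x ->
  exists2 t, X t & x :: D ~= rcons D t.
Proof.
move=> /fundamental_rev FD Xx; have [t Xt e] := fundamental_conj hm FD Xx; exists t => //.
by have := beq_rev hm e; rewrite rev_rcons rev_cons revK.
Qed.

Definition intertwines (Z : pred S) X h :=
  forall x, X x -> exists2 z, Z z & h ++ [:: x] ~= z :: h.

Lemma intertwines_word Z X h u : intertwines Z X h -> all X u ->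
  exists u', [/\ all Z u', size u' = size u & h ++ u ~= u' ++ h].
Proof.
move=> hX; elim: u => [_|x u IH /andP[Xx /IH[u' [Zu' su' uE]]]].
  by exists [::]; split=> //; rewrite cats0; apply: brefl.
have [z Zz zE] := hX x Xx; exists (z :: u'); split=> //=; rewrite ?Zz ?su' //.
rewrite -cat1s catA; apply: beq_trans (beq_catr u zE) _.
exact: (beq_cons z uE).
Qed.

(** The letters in h X h^-1, as a predicate so that they can serve as a new X. *)
Definition conj_letters X h : pred S :=
  fun y : S => `[< exists2 x, X x & h ++ [:: x] ~= y :: h >].

Lemma conj_lettersP Z X h : intertwines Z X h -> intertwines (conj_letters X h) X h.
Proof.
move=> hX x Xx; have [z _ zE] := hX x Xx; exists z => //.
by apply/asboolP; exists x.
Qed.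

Lemma conj_letters_word X h u' : all (conj_letters X h) u' ->
  exists u, [/\ all X u, size u' = size u & h ++ u ~= u' ++ h].
Proof.
elim: u' => [_|y u' IH /andP[/asboolP[x Xx xE] /IH[u [Xu su uE]]]].
  by exists [::]; split=> //; rewrite cats0; apply: brefl.
exists (x :: u); split=> //=; rewrite ?Xx ?su //.
rewrite -cat1s catA; apply: beq_trans (beq_catr u xE) _.
exact: (beq_cons y uE).
Qed.

(** Conjugation by h matches words over X with words over Y and keeps lengths. So F right-divides
    the image of D, and D right-divides the preimage of F; comparing lengths gives equality. *)
Lemma fundamental_transport Z X h D F : intertwines Z X h -> fundamental X D ->
  fundamental (conj_letters X h) F -> h ++ D ~= F ++ h.
Proof.
set Y := conj_letters X h => hX FD FF.
have hXY : intertwines Y X h := conj_lettersP hX.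
have [XD rD lD rrD] := FD; have [YF rF lF rrF] := FF.
have [E [YE sE eE]] := intertwines_word hXY XD.
have [G [XG sG eG]] := conj_letters_word YF.
have yE y : Y y -> dvd [:: y] (rev E).
  move=> /asboolP[x Xx xE]; apply/(dvd_rev hm [:: y]).
  have /(dvd_rev hm [:: x])[d dE] := rrD x Xx.
  have Xd : all X d by have := beq_all hm X dE; rewrite XD all_cat => /esym/andP[].
  have [e [_ _ deE]] := intertwines_word hXY Xd; exists e.
  apply: (@beq_cancelr _ _ hm h); apply: beq_trans (bsym eE) _.
  apply: beq_trans (beq_catl h dE) _; rewrite catA.
  apply: beq_trans (beq_catr _ deE) _; rewrite -!catA; apply: beq_catl.
  exact: xE.
have xG x : X x -> dvd [:: x] (rev G).
  move=> Xx; apply/(dvd_rev hm [:: x]); have [y Yy xyE] := hXY x Xx.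
  have /(dvd_rev hm [:: y])[f fE] := rrF y Yy.
  have Yf : all Y f by have := beq_all hm Y fE; rewrite YF all_cat => /esym/andP[].
  have [g [_ _ gE]] := conj_letters_word Yf; exists g.
  apply: (@beq_cancel _ _ hm h); apply: beq_trans eG _.
  apply: beq_trans (beq_catr h fE) _; rewrite -catA.
  apply: beq_trans (beq_catl f (bsym xyE)) _; rewrite !catA; apply: beq_catr.
  exact: bsym.
have sDG := dvd_size (right_reduced_dvd hm xG XD rD).
have FE := right_reduced_dvd hm yE YF rF.
apply: beq_trans eE _; apply: beq_catr.
have : rev E ~= rev F.
  apply: (dvd_same_size FE); rewrite !size_rev in sDG *.
  by rewrite sE sG.
by move/(beq_rev hm); rewrite !revK.
Qed.

Lemma wpow_transport h D F n : h ++ D ~= F ++ h -> h ++ wpow D n ~= wpow F n ++ h.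
Proof.
move=> e; elim: n => [|n IH]; first by rewrite cats0; apply: brefl.
rewrite /wpow /= catA; apply: beq_trans (beq_catr _ e) _; rewrite -!catA.
exact: beq_catl.
Qed.

(* The elementary ribbon Delta_{X + t} Delta_X^-1. *)
Section Ribbon.
Variables (X : pred S) (t : S) (D D' v : seq S).
Hypotheses (FD : fundamental X D) (FD' : fundamental (predU1 t X) D').
Hypothesis vE : D' ~= v ++ D.

(** D' permutes the letters of X + t and D those of X, hence v = D' D^-1 sends X into X + t. *)
Lemma ribbon_intertwines : intertwines (predU1 t X) X v.
Proof.
move=> x Xx; have [x' Xx' xE] := fundamental_lconj FD Xx.
have [|y Yy yE] := fundamental_conj hm FD' (x := x'); first by rewrite /= Xx' orbT.
exists y => //; apply: (@beq_cancelr _ _ hm D); rewrite -catA.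
apply: beq_trans (beq_catl v xE) _; rewrite -rcons_cat.
have vDE : rcons (v ++ D) x' ~= rcons D' x'.
  by rewrite -!cats1; apply: beq_catr; apply: bsym.
apply: beq_trans vDE _; apply: beq_trans yE _.
exact: (beq_cons y vE).
Qed.

(* Otherwise Delta_{X + t} would have a word with a square. *)
Lemma ribbon_lreduced : lreduced (conj_letters X v) v.
Proof.
move=> y /asboolP[x Xx xE] [v' v'E].
have v'x : v' ++ [:: x] ~= v.
  apply: (@beq_cancel _ _ hm [:: y]); apply: beq_trans xE.
  rewrite catA; apply: beq_catr; exact: bsym.
have [_ _ /(_ x Xx)[d dE] _] := FD.
have [_ rD' _ _] := FD'.
have : reduced m (v' ++ [:: x] ++ [:: x] ++ d).
  rewrite -(beq_reduced (u := D')) // catA.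
  by apply: beq_trans vE _; apply: beq_cat; first exact: bsym.
move/reduced_catr; rewrite reducedE !wd_cat !wd1 wgenK => /leq_trans/(_ (wlen_le _ _)).
by rewrite /=; lia.
Qed.

End Ribbon.

Lemma ribbon_rdvd X t D D' v h c n : fundamental X D ->
  fundamental (predU1 t X) D' -> D' ~= v ++ D ->
  rcons h t ++ wpow D n.+1 ~= c ++ rcons h t ->
  exists h1, rcons h t ~= h1 ++ v.
Proof.
set Xt := predU1 t X => FD FD' vE E.
have [XD rD _ rrD] := FD; have [XD' rD' _ _] := FD'.
have iv := ribbon_intertwines FD FD' vE.
have [F FF] := fundamental_exists hm hsph (conj_letters X v).
have vD := fundamental_transport iv FD FF.
have XtD : all Xt D by apply: sub_all XD => x Xx; rewrite /Xt /= Xx orbT.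
have Xtv : all Xt v.
  by have := beq_all hm Xt vE; rewrite XD' all_cat => /esym/andP[].
have div x : Xt x -> dvd [:: x] (rev (rcons h t ++ wpow D n.+1)).
  move=> /predU1P[->|Xx].
    apply: (dvd_beqr hm (bsym (beq_rev hm E))).
    by rewrite rev_cat rev_rcons; apply: (dvd_catr m [:: t]).
  rewrite wpowSr catA rev_cat; apply: dvd_trans (rrD x Xx) _; exact: dvd_catr.
have /(dvd_rev hm)[z zE] := right_reduced_dvd hm div XD' rD'.
have {zE} zE : rcons h t ++ wpow D n ~= z ++ v.
  apply: (@beq_cancelr _ _ hm D); rewrite -catA -wpowSr.
  apply: beq_trans zE _; rewrite -catA; exact: beq_catl.
have vh : dvd (rev v) (rev (wpow D n) ++ rev (rcons h t)).
  by rewrite -rev_cat; apply/(dvd_rev hm); exists z.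
have XDn : all Xt (rev (wpow D n)) by rewrite all_rev all_wpow.
have Xrv : all Xt (rev v) by rewrite all_rev.
(* In reversed words: [rev p ++ wpow D n] is the least common left multiple of v and D^n, and
   [rev p] right-divides h t. *)
have [p [Xp [q qE] puniv]] := lcm_complement hm XDn Xrv vh.
have vDn := wpow_transport n vD.
have [r rE] : exists r, v ~= r ++ rev p.
  apply/(dvd_rev hm); rewrite revK; apply: puniv; rewrite -rev_cat.
  by apply/(dvd_rev hm); exists (wpow F n).
have pq : rev p ++ wpow D n ~= rev q ++ v.
  by have := beq_rev hm qE; rewrite !rev_cat !revK.
have rq : r ++ rev q ~= wpow F n.
  apply: (@beq_cancelr _ _ hm v); apply: beq_trans vDn; rewrite -catA.
  apply: beq_trans (beq_catl r (bsym pq)) _; rewrite catA.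
  by apply: beq_catr; apply: bsym.
(* Since r is a left factor of F^n, its first letter would lie in Y and divide v on the left. *)
have r0 : r = [::].
  case: r rE rq => // y r rE rq; have [YF _ _ _] := FF.
  have := beq_all hm (conj_letters X v) rq; rewrite all_wpow // => /andP[Yy _].
  case: (ribbon_lreduced FD FD' vE Yy).
  by exists (r ++ rev p).
have /(dvd_rev hm)[h1 h1E] : dvd (rev (rev p)) (rev (rcons h t)).
  by rewrite revK; apply: puniv.
exists h1; apply: beq_trans h1E _; apply: beq_catl; apply: bsym.
by rewrite r0 in rE.
Qed.

(** With h = h1 v, the equation passes to h1 and Y = v X v^-1 with the same c. The target is all
    letters and c is arbitrary because Y changes along the induction. *)
Lemma conj_fundamental_intertwines X D h c n : fundamental X D -> rreduced X h ->
  h ++ wpow D n.+1 ~= c ++ h -> intertwines predT X h.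
Proof.
have [N] := ubnP (size h); elim: N h X D => // N IH h X D hN FD hr E.
case/lastP: h hN hr E => [|h t] hN hr E.
  by move=> x _; exists x => //; apply: brefl.
have Xt : ~ X t.
  move=> Xt; case: (hr t Xt); rewrite rev_rcons; exact: (dvd_catr m [:: t]).
have [XD rD _ rrD] := FD.
have [D' FD'] := fundamental_exists hm hsph (predU1 t X).
have XtD : all (predU1 t X) D by apply: sub_all XD => x Xx; rewrite /= Xx orbT.
have [v vE] := fundamental_rdvd hm FD' XtD rD.
have [h1 h1E] := ribbon_rdvd FD FD' vE E.
have iv := ribbon_intertwines FD FD' vE; set Y := conj_letters X v.
have [F FF] := fundamental_exists hm hsph Y.
have vDn := wpow_transport n.+1 (fundamental_transport iv FD FF).
have E1 : h1 ++ wpow F n.+1 ~= c ++ h1.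
  apply: (@beq_cancelr _ _ hm v); rewrite -catA -[X in _ ~= X]catA.
  apply: beq_trans (beq_catl h1 (bsym vDn)) _; rewrite catA.
  apply: beq_trans (beq_catr _ (bsym h1E)) _; apply: beq_trans E _.
  exact: beq_catl.
have hr1 : rreduced Y h1.
  move=> y /asboolP[x Xx xE] /(dvd_rev hm [:: y])[h2 h2E].
  case: (hr x Xx); apply/(dvd_rev hm [:: x]); exists (h2 ++ v).
  apply: beq_trans h1E _; apply: beq_trans (beq_catr v h2E) _; rewrite -!catA.
  by apply: beq_catl; apply: bsym.
have s1 : (size h1 < N)%N.
  (* If v were empty, D' would equal D and t would lie in X. *)
  have sv : size v != 0%N.
    apply/eqP => /size0nil v0; rewrite v0 cat0s in vE.
    have [_ _ /(_ t) tD' _] := FD'.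
    have [z zE] : dvd [:: t] D' by apply: tD'; rewrite /= eqxx.
    apply: Xt; have := beq_all hm X (beq_trans (bsym vE) zE).
    by rewrite XD /= => /esym/andP[].
  by have := beq_size h1E; rewrite size_cat; lia.
have i1 := IH h1 Y F s1 FF hr1 E1.
move=> x Xx; have [y Yy yE] := conj_lettersP iv Xx.
have [z _ zE] := i1 y Yy; exists z => //.
apply: beq_trans (beq_catr _ h1E) _; rewrite -catA.
apply: beq_trans (beq_catl h1 yE) _; rewrite -cat1s catA.
apply: beq_trans (beq_catr v zE) _; rewrite cat_cons; apply: beq_cons.
exact: bsym.
Qed.

(** Starting D with x makes the image z of x the first letter of a word equivalent to c, and c is
    over X. *)
Lemma conj_fundamental X D h c n : fundamental X D -> rreduced X h -> all X c ->
  h ++ wpow D n.+1 ~= c ++ h -> intertwines X X h.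
Proof.
move=> FD hr Xc E; have ih := conj_fundamental_intertwines FD hr E.
move=> x Xx; have [z _ zE] := ih x Xx; exists z => //.
have [XD _ /(_ x Xx)[d dE] _] := FD.
have XdD : all X (d ++ wpow D n).
  have := beq_all hm X dE; rewrite XD all_cat => /esym/andP[_ Xd].
  by rewrite all_cat Xd all_wpow.
have [e [_ _ eE]] := intertwines_word ih XdD.
have ce : c ~= z :: e.
  apply: (@beq_cancelr _ _ hm h); apply: beq_trans (bsym E) _.
  rewrite /wpow /= -/(wpow D n); apply: beq_trans (beq_catl h (beq_catr _ dE)) _.
  rewrite -catA catA; apply: beq_trans (beq_catr _ zE) _.
  exact: (beq_cons z eE).
by have := beq_all hm X ce; rewrite Xc => /esym/andP[].
Qed.

End Ribbons.

(** * Artin-Tits groups of spherical type *)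

Section SubgroupClosure.
Variables (G : groupType) (Y : set G).
Implicit Types (g h : G) (H : set G).

Lemma gen_subgroup1 : gen_subgroup Y 1.
Proof. by move=> H [[/= H1 _] _]; rewrite in_setE in H1. Qed.

Lemma gen_subgroupM g h : gen_subgroup Y g -> gen_subgroup Y h ->
  gen_subgroup Y (g * h).
Proof.
move=> gY hY H HC; have [[H1 HM] YH] := HC; rewrite -in_setE.
by apply: group_closedM; [|rewrite inE; exact: gY|rewrite inE; exact: hY].
Qed.

Lemma gen_subgroupV g : gen_subgroup Y g -> gen_subgroup Y g^-1.
Proof.
move=> gY H HC; have [HG YH] := HC; rewrite -in_setE.
by apply: group_closedV; rewrite ?inE //; exact: gY.
Qed.

Lemma gen_subgroup_gen g : Y g -> gen_subgroup Y g.
Proof. by move=> gY H [_ YH]; apply: YH. Qed.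

Lemma gen_subgroup_min H : H 1 -> (forall g h, H g -> H h -> H (g * h)) ->
  (forall g, H g -> H g^-1) -> (forall g, Y g -> H g) ->
  forall g, gen_subgroup Y g -> H g.
Proof.
move=> H1 HM HV YH g; apply; split=> //; split; first by rewrite in_setE.
by move=> x y; rewrite !in_setE => Hx Hy; apply/HM/HV.
Qed.

Lemma gen_subgroupX g n : gen_subgroup Y g -> gen_subgroup Y (g ^+ n).
Proof.
move=> gY; elim: n => [|n IH]; first exact: gen_subgroup1.
by rewrite expgS; apply: gen_subgroupM.
Qed.

Lemma gen_subgroup_conj c : (forall y, Y y -> gen_subgroup Y (c * y * c^-1)) ->
  forall g, gen_subgroup Y g -> gen_subgroup Y (c * g * c^-1).
Proof.
move=> cY; apply: gen_subgroup_min => // [|g h gY hY|g gY].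
- by rewrite mulg1 mulgV; apply: gen_subgroup1.
- have -> : c * (g * h) * c^-1 = (c * g * c^-1) * (c * h * c^-1).
    by rewrite !mulgA mulgVK.
  exact: gen_subgroupM.
- have -> : c * g^-1 * c^-1 = (c * g * c^-1)^-1 by rewrite !invgM invgK mulgA.
  exact: gen_subgroupV.
Qed.

End SubgroupClosure.

Section Artin.
Variables (S : finType) (m : S -> S -> option nat).
Hypothesis hm : coxeter_matrix m.
Hypothesis hsph : spherical_type m.
Local Notation dvd := (@dvd S m).
Local Infix "~=" := (@beq S m) (at level 70).
Implicit Types (u v w a b c d : seq S) (s t x : S) (X : {set S}).
Local Notation brefl := (beq_refl m _).
Local Notation bsym := (beq_sym hm).
Local Notation fundamental := (@is_fundamental S m).
Local Notation G := (artin_group m).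
Local Notation gen := (@pres_gen S (braid_rel m)).
Definition cl (u : seq S) : G := cls (braid_rel m) u.

Lemma cl_cat u v : cl (u ++ v) = cl u * cl v. Proof. exact: cls_cat. Qed.
Lemma cl_cons s u : cl (s :: u) = gen s * cl u. Proof. exact: cls_cons. Qed.
Lemma cl1 s : cl [:: s] = gen s. Proof. by []. Qed.
Lemma clE u v : cl u = cl v <-> u ~= v.
Proof.
split=> [/pres_classE|]; first exact: pres_eq_beq.
elim=> // p q s t k w st mst _ <-; rewrite !cl_cat; congr (_ * (_ * _)).
apply/pres_classE.
have := @PresRel _ (braid_rel m) [::] [::] (alternating k s t) (alternating k t s).
by rewrite /= !cats0; apply; exists s, t, k.
Qed.

Lemma gen_inj : injective gen.
Proof.
move=> s t; rewrite -!cl1 => /clE /(beq_first hm); have [//|st [k [z [mst e _]]]] := eqVneq s t.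
by have := beq_size e; have := cox_ge2 hm st mst; rewrite /= size_cat size_alt; lia.
Qed.

Lemma cl_wpow u n : cl (wpow u n) = cl u ^+ n.
Proof. by elim: n => //= n IH; rewrite /wpow /= cl_cat expgS -IH. Qed.

Lemma group_gen_ind (H : set G) : H 1 -> (forall g h : G, H g -> H h -> H (g * h)) ->
  (forall g, H g -> H g^-1) -> (forall s, H (gen s)) -> forall g, H g.
Proof.
move=> H1 HM HV Hgen g; rewrite -[g]pres_class_repr.
elim: (repr g) => [|[s b] w IH] //; rewrite -cat1s pres_class_cat.
by apply: HM => //; rewrite pres_class_letter; case: b; [apply: HV|].
Qed.

Section Parabolic.
Variable X : {set S}.
Local Notation XA := (artin_gens m X).
Local Notation AX := (gen_subgroup XA).
Local Notation inX := (fun s => s \in X).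

Lemma gen_in_gens s : s \in X -> XA (gen s).
Proof. by move=> sX; exists s. Qed.

Lemma cl_in_subgroup u : all inX u -> AX (cl u).
Proof.
elim: u => [_|s u IH /andP[sX uX]]; first exact: gen_subgroup1.
rewrite cl_cons; apply: gen_subgroupM (IH uX); apply: gen_subgroup_gen.
exact: gen_in_gens.
Qed.

Lemma gen_submonoidP g : gen_submonoid XA g <-> exists2 u, all inX u & g = cl u.
Proof.
split=> [|[u uX ->]].
  move/(_ [set g | exists2 u, all inX u & g = cl u]%classic); apply.
  split=> [|_ [s sX <-]]; last by exists [:: s] => //=; rewrite andbT.
  split; first by rewrite in_setE; exists [::].
  move=> x y; rewrite !in_setE => -[u uX ->] [v vX ->].
  by exists (u ++ v); rewrite ?all_cat ?uX // cl_cat.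
move=> H [[H1 HM] XH]; elim: u uX => [_|s u IH /andP[sX uX]].
  by rewrite -in_setE.
rewrite cl_cons -in_setE; apply: HM; rewrite inE; last exact: IH.
by apply: XH; apply: gen_in_gens.
Qed.

(** Inverses are absorbed through Z = s z, which gives s^-1 = Z^-1 z. It serves twice: with a
    central element of the whole group, and with Delta_X^e in A_X. *)
Lemma fraction Z : all inX Z -> (forall x, x \in X -> dvd [:: x] Z) ->
  central_in AX (cl Z) ->
  forall g, AX g -> exists k b, all inX b /\ g = cl Z ^- k * cl b.
Proof.
move=> ZX Zdvd Zc.
pose H : set G := fun g => exists k b, all inX b /\ g = cl Z ^- k * cl b.
have Hcl b : all inX b -> H (cl b) by move=> bX; exists 0%N, b; rewrite expg0 invg1 mul1g.
have cZ b n : all inX b -> commute (cl b) (cl Z ^+ n).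
  by move=> bX; apply: commuteX; apply: commute_sym; apply: Zc; apply: cl_in_subgroup.
have HM g h : H g -> H h -> H (g * h).
  move=> [k [b [bX ->]]] [l [c [cX ->]]]; exists (k + l)%N, (b ++ c).
  split; first by rewrite all_cat bX.
  rewrite cl_cat.
  have bZ : commute (cl b) (cl Z ^- l) by apply/commuteV/cZ.
  rewrite addnC expgnDr invgM -!mulgA; congr (_ * _).
  by rewrite !mulgA; congr (_ * _); exact: bZ.
have HgenV s : s \in X -> H (gen s)^-1.
  move=> sX; have [z zE] := Zdvd s sX; exists 1%N, z.
  have zX : all inX z by have := beq_all hm inX zE; rewrite ZX all_cat => /esym/andP[].
  split=> //; have zZ : commute (cl z) (cl Z ^- 1) by apply/commuteV/cZ.
  rewrite -zZ expg1; have /clE -> := zE; rewrite cl_cat cl1 invgM mulgA mulgV.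
  by rewrite mul1g.
have HV b : all inX b -> H (cl b)^-1.
  elim: b => [_|x b IH /andP[xX bX]]; first by rewrite invg1; apply: (Hcl [::]).
  by rewrite cl_cons invgM; apply: HM; [apply: IH|apply: HgenV].
apply: (gen_subgroup_min (H := H)) => //; first exact: (Hcl [::]).
  move=> g [k [b [bX ->]]]; rewrite invgM invgK; apply: HM; first exact: HV.
  by rewrite -cl_wpow; apply/Hcl/all_wpow.
by move=> _ [s sX <-]; rewrite -cl1; apply: Hcl; rewrite /= andbT.
Qed.

End Parabolic.

Lemma cl_central C : (forall x, C ++ [:: x] ~= x :: C) ->
  forall g : G, commute (cl C) g.
Proof.
move=> CC; apply: group_gen_ind => [|g h|g|s].
- exact: commute1.
- exact: commuteM.
- exact: commuteV.
by rewrite -cl1 /commute -!cl_cat; apply/clE/CC.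
Qed.

Lemma central_fraction : exists C : G, (forall g : G, commute C g) /\
  forall g : G, exists k u, g = C ^- k * cl u.
Proof.
have [C [/cl_central CC Cdvd]] := central_exists hm hsph.
exists (cl C); split=> // g.
have aT u : all (fun s => s \in [set: S]) u by apply/allP => s _; rewrite inE.
have gT : gen_subgroup (artin_gens m [set: S]) g.
  apply: group_gen_ind g => [|g h|g|s]; [exact: gen_subgroup1|exact: gen_subgroupM|exact: gen_subgroupV|].
  by apply: gen_subgroup_gen; apply: gen_in_gens; rewrite inE.
have Cc : central_in (gen_subgroup (artin_gens m [set: S])) (cl C) by move=> a _.
have [k [u [_ gE]]] := @fraction [set: S] C (aT C) (fun x _ => Cdvd x) Cc g gT.
by exists k, u.
Qed.

(** * The quasi-centralizer and elements conjugating a power of Delta_X into A_X *)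

Section QuasiCentralizer.
Variable X : {set S}.
Local Notation XA := (artin_gens m X).
Local Notation AX := (gen_subgroup XA).
Local Notation inX := (fun s => s \in X).

(** One inclusion suffices, since conjugation by g induces an injection of the finite set X into
    itself. *)
Lemma quasi_centralizerP g : quasi_centralizer XA g <->
  forall x, x \in X -> exists2 z, z \in X & g * gen x = gen z * g.
Proof.
split=> [/seteqP[gX _] x xX|gX].
  have [|_ [z zX <-] zE] := gX (g * gen x); last by exists z.
  by exists (gen x) => //; exists x.
have /choice[f fE] : forall x, exists z, x \in X -> z \in X /\ g * gen x = gen z * g.
  move=> x; have [/gX[z zX zE]|xX] := boolP (x \in X); first by exists z.
  by exists x.
have finj : {in X &, injective f}.
  move=> x y xX yX fxy; apply: gen_inj; apply: (@mulgI _ g).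
  by rewrite (fE x xX).2 (fE y yX).2 fxy.
have fX : f @: X = X.
  apply/eqP; rewrite eqEcard card_in_imset // leqnn andbT.
  by apply/fintype.subsetP => _ /imsetP[x xX ->]; case: (fE x xX).
apply/seteqP; split=> _ [_ [x xX <-] <-].
  by exists (gen (f x)); [exists (f x) => //; case: (fE x xX)|case: (fE x xX) => _ ->].
have : x \in f @: X by rewrite fX.
move=> /imsetP[y yX ->]; exists (gen y); first by exists y.
by case: (fE y yX).
Qed.

Lemma quasi_centralizerVP g : quasi_centralizer XA g ->
  forall x, x \in X -> exists2 z, z \in X & g * gen z = gen x * g.
Proof.
move=> /seteqP[_ gX] x xX; have [|_ [z zX <-] zE] := gX (gen x * g); last by exists z.
by exists (gen x) => //; exists x.
Qed.

Lemma quasi_centralizer_conj (g a : G) : quasi_centralizer XA g -> AX a ->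
  AX (g * a * g^-1).
Proof.
move=> /quasi_centralizerP gX; apply: gen_subgroup_conj => _ [x xX <-].
have [z zX ->] := gX x xX; rewrite mulgK.
by apply: gen_subgroup_gen; apply: gen_in_gens.
Qed.

Lemma quasi_centralizer_conjV (g a : G) : quasi_centralizer XA g -> AX a ->
  AX (g^-1 * a * g).
Proof.
move=> gX; rewrite -{2}[g]invgK; apply: gen_subgroup_conj => _ [x xX <-].
have [z zX zE] := quasi_centralizerVP gX xX; rewrite invgK -mulgA -zE mulKg.
by apply: gen_subgroup_gen; apply: gen_in_gens.
Qed.

Variable D : seq S.
Hypothesis FD : fundamental inX D.

(** The lcm g is a positive word right divisible by D, hence no shorter than D; as D is a common
    multiple, g right-divides D, and equal lengths force equality. *)
Lemma fundamental_unique g : is_Delta XA g -> g = cl D.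
Proof.
have [XD rD lD rrD] := FD.
move=> [[_ _ _] [/gen_submonoidP[u Xu ->] rdu umin]]; apply/clE.
have uD x : x \in X -> dvd [:: x] (rev u).
  move=> xX; have [|c cP] := rdu (gen x); first exact: gen_in_gens.
  have [v Xv ->] := (gen_submonoidP X c).1 cP.
  rewrite -cl1 -cl_cat => /clE uE; apply/(dvd_rev hm [:: x]).
  by exists v.
have /dvd_size := right_reduced_dvd hm uD XD rD; rewrite !size_rev => sDu.
have [||c cP] := umin (cl D).
- by apply/gen_submonoidP; exists D.
- move=> _ [x xX <-]; have /(dvd_rev hm [:: x])[z zE] := rrD x xX.
  exists (cl z); last by rewrite -cl1 -cl_cat; apply/clE.
  apply/gen_submonoidP; exists z => //.
  by have := beq_all hm inX zE; rewrite XD all_cat => /esym/andP[].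
have [v Xv ->] := (gen_submonoidP X c).1 cP.
rewrite -cl_cat => /clE DE; have := beq_size DE; rewrite size_cat.
by case: v Xv DE => [_ /bsym|x v _ _] //=; lia.
Qed.

Lemma quasi_centralizer_Delta g : quasi_centralizer XA g -> g * cl D = cl D * g.
Proof.
have [XD rD lD rrD] := FD.
move=> gQ; have gX := (quasi_centralizerP g).1 gQ.
have word u : all inX u -> exists v, [/\ all inX v, size v = size u & g * cl u = cl v * g].
  elim: u => [_|x u IH /andP[xX /IH[v [vX sv vE]]]].
    by exists [::]; rewrite mulg1 mul1g.
  have [z zX zE] := gX x xX; exists (z :: v); split; rewrite /= ?zX ?sv //.
  by rewrite cl_cons mulgA zE -mulgA vE cl_cons mulgA.
have [E [EX sE gE]] := word D XD; rewrite gE; congr (_ * _); apply/clE.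
have ED x : x \in X -> dvd [:: x] (rev E).
  move=> xX; have [y yX yE] := quasi_centralizerVP gQ xX.
  have /(dvd_rev hm [:: y])[d dE] := rrD y yX.
  have dX : all inX d by have := beq_all hm inX dE; rewrite XD all_cat => /esym/andP[].
  have [d' [_ _ d'E]] := word d dX; apply/(dvd_rev hm [:: x]); exists d'; apply/clE.
  apply: (@mulIg _ g); rewrite -gE; have /clE -> := dE.
  by rewrite !cl_cat !cl1 mulgA d'E -mulgA yE mulgA.
have := right_reduced_dvd hm ED XD rD => h.
have : rev E ~= rev D by apply: (dvd_same_size h); rewrite !size_rev sE.
by move=> /(beq_rev hm); rewrite !revK.
Qed.

Lemma quasi_centralizer_central (c g : G) : (forall h : G, commute c h) ->
  quasi_centralizer XA g -> quasi_centralizer XA (c * g).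
Proof.
move=> cc /quasi_centralizerP gX; apply/quasi_centralizerP => x /gX[z zX zE].
by exists z => //; rewrite -mulgA zE !mulgA (cc (gen z)).
Qed.

Variable e : nat.
Hypothesis e0 : (0 < e)%N.
Hypothesis De : central_in AX (cl D ^+ e).

Lemma conj_Delta_decomposition g n : AX (g * cl D ^+ n.+1 * g^-1) ->
  set_mul AX (quasi_centralizer XA) g.
Proof.
have [XD rD lD rrD] := FD.
have [C [CC /(_ g)[k [g' ->]]]] := central_fraction.
have [y [h0 [yX h0r /clE->]]] := lreduced_split m inX g'.
have [h [z [hr zX hE]]] := rreduced_split hm inX h0.
have hl : lreduced m inX h.
  move=> x xX [w wE]; apply: (h0r x xX); exists (w ++ z).
  by apply: beq_trans hE _; rewrite catA; apply: beq_catr.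
have hE' : cl h0 = cl h * cl z by rewrite -cl_cat; apply/clE.
rewrite cl_cat hE' => gA.
have CVC i (x : G) : commute (C ^- i) x.
  by apply/commute_sym/commuteV/commuteX/commute_sym.
have AXy := cl_in_subgroup yX; have AXyV := gen_subgroupV AXy.
have cconj (p a : G) : C ^- k * p * a * (C ^- k * p)^-1 = p * a * p^-1.
  by rewrite (CVC k p) invgM -!mulgA (CVC k (a * _)) -!mulgA -(CVC k p^-1) mulKg.
have yconj (p a : G) : p * a * p^-1 = (cl y)^-1 * (cl y * p * a * (cl y * p)^-1) * cl y.
  by rewrite invgM -!mulgA mulKg mulVg mulg1.
have conjX (p a : G) i : p * a ^+ i * p^-1 = (p * a * p^-1) ^+ i.
  have conjE (x : G) : p * x * p^-1 = x ^ p^-1 by rewrite /conjg invgK mulgA.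
  by rewrite !conjE conjXg.
rewrite cconj in gA; set b := cl h * cl z in gA.
have {gA} bA : AX (b * cl D ^+ n.+1 * b^-1).
  by rewrite yconj; apply: gen_subgroupM => //; apply: gen_subgroupM.
(* The e-th power of the conjugate removes z, which commutes with Delta_X^e. *)
have {bA} : AX (cl h * cl D ^+ (n.+1 * e) * (cl h)^-1).
  have -> : cl h * cl D ^+ (n.+1 * e) * (cl h)^-1 = (b * cl D ^+ n.+1 * b^-1) ^+ e.
    rewrite -conjX -expgnA /b.
    have zD : commute (cl z) (cl D ^+ (n.+1 * e)).
      rewrite mulnC expgnA; apply: commuteX; apply: commute_sym; apply: De.
      exact: cl_in_subgroup.
    by rewrite invgM -!mulgA; congr (_ * _); rewrite mulgA zD -mulgA mulVKg.
  exact: gen_subgroupX.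
have : (0 < n.+1 * e)%N by rewrite muln_gt0.
case: (n.+1 * e)%N => // {}n _ hA.
pose Z := wpow D e.
have ZX : all inX Z by apply: all_wpow.
have Zdvd x : x \in X -> dvd [:: x] Z.
  move=> xX; rewrite /Z; case: e e0 => // e' _.
  by apply: dvd_trans (lD x xX) _; apply: dvd_catr.
have Zc : central_in AX (cl Z) by rewrite cl_wpow.
clear b; have [l [b [bX bE]]] := fraction ZX Zdvd Zc hA.
have bE' : cl b = cl Z ^+ l * (cl h * cl D ^+ n.+1 * (cl h)^-1) by rewrite bE mulVKg.
have E : wpow Z l ++ (h ++ wpow D n.+1) ~= b ++ h.
  by apply/clE; rewrite (cl_cat _ (h ++ _)) (cl_cat h) (cl_cat b) bE' (cl_wpow Z) (cl_wpow D) -!mulgA mulVg mulg1.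
(* As no letter of X divides h on the left, the denominator Z^l divides b and cancels, leaving h
   D^n.+1 = c h with c positive over X. *)
have [c cX cE] := lreduced_quotient hm hl (all_wpow l ZX) bX E.
have E' : h ++ wpow D n.+1 ~= c ++ h.
  apply: (@beq_cancel _ _ hm (wpow Z l)); apply: beq_trans E _.
  by rewrite catA; apply: beq_catr.
have ih := conj_fundamental hm hsph FD hr cX E'.
have hQ : quasi_centralizer XA (cl h).
  apply/quasi_centralizerP => x xX; have [t tX tE] := ih x xX; exists t => //.
  by rewrite -cl1 -cl_cat -cl_cons; apply/clE.
(* Moving z across h turns g = C^-k y h z into (y z') (C^-k h). *)
have [z' [z'X _ /clE z'E]] := intertwines_word ih zX.
exists (cl (y ++ z')); first by apply: cl_in_subgroup; rewrite all_cat yX.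
exists (C ^- k * cl h); first exact: quasi_centralizer_central (CVC k) hQ.
rewrite !cl_cat in z'E *.
by rewrite mulgA -(CVC k (_ * _)) -!mulgA z'E.
Qed.

End QuasiCentralizer.
End Artin.

(** * Finite index and the equality of the four sets *)

Lemma finite_index_refl (G : groupType) (H : set G) :
  H 1 -> (forall g h, H g -> H h -> H (g * h)) -> (forall g, H g -> H g^-1) ->
  finite_index H H.
Proof.
move=> H1 HM HV; apply: (sub_finite_set (B := [set H]%classic)); last exact: finite_set1.
move=> _ [h Hh <-] /=; apply/seteqP; split=> [_ [k Hk <-]|k Hk]; first exact: HM.
by exists (h^-1 * k); [apply: HM => //; apply: HV|rewrite mulVKg].
Qed.

Lemma finite_index_power (G : groupType) (K H : set G) (f : nat -> G) :
  K 1 -> finite_index K H -> (forall i, H (f i)) ->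
  exists i j, (i < j)%N /\ K ((f i)^-1 * f j).
Proof.
move=> K1 fin Hf; pose coset i := [set f i * k | k in K]%classic.
have [inj|] := pselect (forall i j, coset i = coset j -> i = j).
  case: infinite_nat; apply: sub_finite_set (finite_preimage (f := coset) _ fin).
    by move=> i _; exists (f i).
  by move=> i j _ _; apply: inj.
move=> /existsNP[i /existsNP[j /not_implyP[ij /eqP neq]]].
wlog lt_ij : i j ij neq / (i < j)%N.
  move=> wl; have := neq; rewrite neq_ltn => /orP[]; first exact: (wl i j).
  by apply: (wl j i); rewrite 1?eq_sym.
exists i, j; split=> //.
have : coset j (f j) by exists 1; rewrite ?mulg1.
by rewrite -ij => -[k Kk <-]; rewrite mulKg.
Qed.

Theorem mainTheorem1 (S : finType) (m : S -> S -> option nat)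
    (hm : coxeter_matrix m) (hsph : spherical_type m) (X : {set S}) :
  let XA : set (artin_group m) := artin_gens m X in
  let AX : set (artin_group m) := gen_subgroup XA in
  forall (Delta : artin_group m) (hDelta : is_Delta XA Delta)
    (e : nat) (he : is_epsilon AX Delta e),
  [/\ centralizer (Delta ^+ e) = commensurator AX,
      commensurator AX = normalizer XA
    & normalizer XA = set_mul AX (quasi_centralizer XA)].
Proof.
move=> XA AX Delta hDelta e [e12 De _].
have [D FD] := fundamental_exists hm hsph (fun s => s \in X).
have DeltaE := fundamental_unique hm hsph FD hDelta.
have e0 : (0 < e)%N by move: e12; rewrite !inE => /orP[]/eqP->.
rewrite DeltaE in De *; clear Delta hDelta DeltaE.
have AXD n : AX (cl m D ^+ n).
  by apply: gen_subgroupX; apply: cl_in_subgroup; case: FD.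
have main g n := conj_Delta_decomposition hm hsph FD e0 De (g := g) (n := n).
have conjA g b : set_mul AX (quasi_centralizer XA) g -> AX b -> AX (g * b * g^-1).
  move=> [a aX [q qX <-]] bX.
  have -> : a * q * b * (a * q)^-1 = a * (q * b * q^-1) * a^-1.
    by rewrite invgM !mulgA.
  apply: gen_subgroupM; last exact: gen_subgroupV.
  by apply: gen_subgroupM => //; apply: quasi_centralizer_conj.
have conjAV g b : set_mul AX (quasi_centralizer XA) g -> AX b -> AX (g^-1 * b * g).
  move=> [a aX [q qX <-]] bX.
  have -> : (a * q)^-1 * b * (a * q) = q^-1 * (a^-1 * b * a) * q.
    by rewrite invgM !mulgA.
  apply: quasi_centralizer_conjV => //; apply: gen_subgroupM => //.
  by apply: gen_subgroupM => //; apply: gen_subgroupV.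
have com : commensurator AX = set_mul AX (quasi_centralizer XA).
  apply/seteqP; split=> [g [_ fin]|g gA].
    (* Two of these elements of g A_X g^-1 lie in the same coset of the intersection, so some g
       Delta_X^(j-i) g^-1 with i < j lies in A_X. *)
    pose f n := g * cl m D ^+ n * g^-1.
    have [||i [j [ij [_ Kij]]]] := finite_index_power (f := f) _ fin.
    - by split; [exists 1; rewrite ?mulg1 ?mulgV //|]; apply: gen_subgroup1.
    - by move=> i; exists (cl m D ^+ i).
    apply: (main g (j - i).-1); rewrite prednK ?subn_gt0 //.
    suff <- : (f i)^-1 * f j = g * cl m D ^+ (j - i) * g^-1 by [].
    rewrite /f !invgM invgK -!mulgA mulKg; congr (_ * _); rewrite !mulgA; congr (_ * _).
    by rewrite -[in cl m D ^+ j](subnKC (ltnW ij)) expgnDr mulKg.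
  rewrite /commensurator /=.
  (* For g in A_X QZ the conjugate is A_X itself, so both indices are 1. *)
  have -> : [set g * a * g^-1 | a in AX]%classic = AX.
    apply/seteqP; split=> [_ [a aX <-]|a aX]; first exact: conjA.
    by exists (g^-1 * a * g); [exact: conjAV|rewrite !mulgA mulgV mul1g mulgK].
  rewrite setIid; split; apply: finite_index_refl;
    [exact: gen_subgroup1|exact: gen_subgroupM|exact: gen_subgroupV
    |exact: gen_subgroup1|exact: gen_subgroupM|exact: gen_subgroupV].
have norm : normalizer XA = set_mul AX (quasi_centralizer XA).
  apply/seteqP; split=> [g gN|g gA].
    apply: (main g 0%N); apply: gen_subgroup_conj (AXD 1%N) => y yX.
    have [|a aX aE] := gN (g * y); first by exists y.
    by rewrite -aE mulgK.
  move=> _ [y yX <-]; exists (g * y * g^-1); last by rewrite mulgVK.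
  by apply: conjA => //; apply: gen_subgroup_gen.
split; [|by rewrite com norm|exact: norm].
rewrite com; apply/seteqP; split=> [g gZ|_ [a aX [q qX <-]]].
  apply: (main g e.-1); rewrite prednK //.
  by move: gZ; rewrite /centralizer /= => ->; rewrite mulgK; apply: AXD.
rewrite /centralizer /= mulgA (De a aX) -!mulgA; congr (_ * _).
by apply: commuteX; apply: (quasi_centralizer_Delta hm hsph FD qX).
Qed.
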